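(* Let $\mathfrak q=\mathrm{Lie}\,Q$ be a finite-dimensional quadratic Lie algebra over $\mathbb K$ with $[\mathfrak q,\mathfrak q]\ne0$, where $Q$ is an algebraic group, and let $n\ge2$. If $p=\prod_{i=1}^n(t-a_i)$ with $a_i\ne a_j$ for $i\neq j$, and the Gaudin Hamiltonians $\tilde{\mathcal H}_k$ are associated with $\vec z=(a_1,\dots,a_n)$, then $\tilde{\mathcal H}_k\in\psi_p(\mathcal Z_v)$ and $\tilde{\mathcal H}_k\in\mathcal Z(p,p+1)$ for each $k$.
   Context: $\mathbb K$ is an algebraically closed field of characteristic $0$. $\mathfrak q$ is quadratic: there is a non-degenerate $Q$-invariant symmetric bilinear form on $\mathfrak q$; $\{x_i\}$ is an orthonormal basis of $\mathfrak q$ for it. For monic $p$ of degree $n$, $\mathfrak q[t]/(p)$ is identified, as a vector space, with $\mathbb W=\bigoplus_{k=0}^{n-1}\mathfrak q\bar t^{\,k}$, $\bar t=t+(p)$; the resulting Lie bracket is $[\,,]_p$, the Lie–Poisson bracket on $\mathcal S(\mathbb W)$ is $\{\,,\}_p$ and $\mathcal Z_p$ is its Poisson centre. For monic $p_1\ne p_2$ of degree $n$ with $\deg(p_1-p_2)\le1$, $\mathcal Z(p_1,p_2)\subset\mathcal S(\mathbb W)$ is the subalgebra generated by all $\mathcal Z_{ap_1+(1-a)p_2}$, $a\in\mathbb K$. $\psi_p:\mathcal S(\mathfrak q[t])\to\mathcal S(\mathbb W)$ extends the quotient map $\mathfrak q[t]\to\mathfrak q[t]/(p)$. When $p$ has distinct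 roots $a_1,\dots,a_n$, put $r_i=\frac{p}{t-a_i}\prod_{j\ne i}(a_i-a_j)^{-1}$ and $\bar r_i=r_i+(p)$; then $(\mathbb W,[\,,]_p)=\bigoplus_i\mathfrak q\bar r_i\cong\mathfrak q^{\oplus n}$. With $\boldsymbol h[\bar r_k,\bar r_j]=\sum_ix_i\bar r_k\,x_i\bar r_j$, the Gaudin Hamiltonians associated with $\vec z=(z_1,\dots,z_n)$ (pairwise distinct entries) are $\sum_{j\ne k}\frac{1}{z_k-z_j}\boldsymbol h[\bar r_k,\bar r_j]\in\mathcal S(\mathbb W)$, $1\le k\le n$. $\mathcal Z(\widehat{\mathfrak q},t^{-1})=\mathcal S(t^{-1}\mathfrak q[t^{-1}])^{\mathfrak q[t]}$, where $\mathcal S(t^{-1}\mathfrak q[t^{-1}])$ is regarded as the quotient of $\mathcal S(\mathfrak q[t,t^{-1}])$ by the ideal generated by $\mathfrak q[t]$. $\mathcal Z(\widehat{\mathfrak q},t+1)\subset\mathcal S(\mathfrak q[t])$ is its image under the algebra homomorphism $xt^{-k}\mapsto x(t+1)^k$. $\mathcal Z_v\subset\mathcal S(\mathfrak q[t])$ is the subalgebra generated by the lowest $t$-components of elements of $\mathcal Z(\widehat{\mathfrak q},t+1)$, where $y_1t^{k_1}\cdots y_dt^{k_d}$ has $t$-degree $\sum k_i$. *)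

(* Defs.v *)
From HB Require Import structures.
From mathcomp Require Import all_boot all_order all_algebra.
From mathcomp Require Import finmap.
From mathcomp Require Import monalg.

Set Implicit Arguments.
Unset Strict Implicit.
Unset Printing Implicit Defensive.

Import GRing.Theory.
Local Open Scope ring_scope.

(** ** Symmetric algebras

    A symmetric algebra S(V) is represented, after the choice of a basis of V
    indexed by I, as the polynomial algebra on I (I may be infinite). *)

Notation Sym K I := {malg K[{cmonom I}]}.

Definition svar (K : fieldType) (I : choiceType) (v : I) : Sym K I :=
  << ucm v >>.
Arguments svar K {I} v.

(* Value of the monomial m when each variable v is replaced with h v. *)
Definition moneval (R : comNzRingType) (I : choiceType) (h : I -> R)
    (m : {cmonom I}) : R :=
  \prod_(v <- finsupp m) h v ^+ m v.

Definition seval (K : fieldType) (I : choiceType) (h : I -> K)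
    (F : Sym K I) : K :=
  mmap idfun (moneval h) F.

(* The K-algebra homomorphism S(V) -> S(W) given by v |-> h v on the basis. *)
Definition shom (K : fieldType) (I J : choiceType) (h : I -> Sym K J)
    (F : Sym K I) : Sym K J :=
  mmap (@malgC {cmonom J} K) (moneval h) F.

(* The K-linear derivation of S(V) given by v |-> D v on the basis. *)
Definition sder (K : fieldType) (I : choiceType) (D : I -> Sym K I)
    (F : Sym K I) : Sym K I :=
  \sum_(m <- msupp F) \sum_(v <- finsupp m)
     (F@_m *+ m v) *: (<< divcm m (ucm v) >> * D v).

(* {F, G} = \sum_(u, v) [u, v] (dF/du) (dG/dv), for a bracket b given on the
   basis. *)
Definition lie_poisson (K : fieldType) (I : choiceType)
    (b : I -> I -> Sym K I) (F G : Sym K I) : Sym K I :=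
  sder (fun u => sder (fun v => b u v) G) F.

Inductive subalg_gen (K : fieldType) (A : algType K) (S : A -> Prop) :
    A -> Prop :=
| subalg_gen_incl f : S f -> subalg_gen S f
| subalg_gen_scal (c : K) : subalg_gen S c%:A
| subalg_gen_add f g :
    subalg_gen S f -> subalg_gen S g -> subalg_gen S (f + g)
| subalg_gen_mul f g :
    subalg_gen S f -> subalg_gen S g -> subalg_gen S (f * g).

(** ** Linear algebraic groups and their Lie algebras *)

Definition mxval (K : fieldType) (N : nat) (g : 'M[K]_N)
    (ij : 'I_N * 'I_N) : K := g ij.1 ij.2.

(* Zariski closed subgroups of GL_N(K). *)
Definition algebraic_group (K : fieldType) (N : nat)
    (Q : 'M[K]_N -> Prop) : Prop :=
  [/\ exists E : Sym K ('I_N * 'I_N)%type -> Prop, forall g : 'M[K]_N,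
        Q g <-> (g \in unitmx /\ forall f, E f -> seval (mxval g) f = 0),
      Q 1%:M,
      forall g h, Q g -> Q h -> Q (g *m h)
    & forall g, Q g -> Q (invmx g)].

(* The differential at the identity, in the direction X, of a polynomial
   function on N x N matrices. *)
Definition diff1 (K : fieldType) (N : nat) (X : 'M[K]_N)
    (f : Sym K ('I_N * 'I_N)%type) : K :=
  seval (mxval 1%:M) (sder (fun ij => (mxval X ij)%:MP) f).

(* The tangent space of Q at the identity, inside gl_N.  Polynomials in the
   matrix entries suffice: if f / det^k vanishes on Q then so does f, and both
   have the same differential at 1. *)
Definition tangent1 (K : fieldType) (N : nat) (Q : 'M[K]_N -> Prop)
    (X : 'M[K]_N) : Prop :=
  forall f, (forall g, Q g -> seval (mxval g) f = 0) -> diff1 X f = 0.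

Definition lie_bracket (K : fieldType) (q : vectType K)
    (br : q -> q -> q) : Prop :=
  [/\ forall u, linear (br u),
      forall v, linear (br^~ v),
      forall u, br u u = 0
    & forall u v w, br u (br v w) + br v (br w u) + br w (br u v) = 0].

(* phi is an isomorphism from the Lie algebra (q, br) onto Lie Q. *)
Definition lie_of_group (K : fieldType) (N : nat) (Q : 'M[K]_N -> Prop)
    (q : vectType K) (br : q -> q -> q) (phi : {linear q -> 'M[K]_N}) : Prop :=
  [/\ injective phi,
      forall X, tangent1 Q X <-> exists u, phi u = X
    & forall u v, phi (br u v) = phi u *m phi v - phi v *m phi u].

(* Invariance under Ad(g), transported along phi. *)
Definition group_invariant (K : fieldType) (N : nat) (Q : 'M[K]_N -> Prop)
    (q : vectType K) (phi : {linear q -> 'M[K]_N}) (B : q -> q -> K) : Prop :=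
  forall g u v u' v', Q g ->
    phi u' = g *m phi u *m invmx g -> phi v' = g *m phi v *m invmx g ->
    B u' v' = B u v.

Definition quadratic_form (K : fieldType) (N : nat) (Q : 'M[K]_N -> Prop)
    (q : vectType K) (phi : {linear q -> 'M[K]_N}) (B : q -> q -> K) : Prop :=
  [/\ forall u, scalar (B u),
      forall u v, B u v = B v u,
      forall u, (forall v, B u v = 0) -> u = 0
    & group_invariant Q phi B].

Definition orthonormal_basis (K : fieldType) (q : vectType K)
    (B : q -> q -> K) (d : nat) (x : d.-tuple q) : Prop :=
  basis_of fullv x /\
  forall i j : 'I_d, B (tnth x i) (tnth x j) = (i == j)%:R.

(** ** Current algebras

    In what follows x is a basis of q. *)

(* The coefficient of x_s in [x_i, x_j]. *)
Definition strcst (K : fieldType) (q : vectType K) (br : q -> q -> q)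
    (d : nat) (x : d.-tuple q) (i j s : 'I_d) : K :=
  coord x s (br (tnth x i) (tnth x j)).

(* In Sym K ('I_d * nat), the basis of q[t]: (i, k) stands for x_i t^k; this
   is the element x_i f(t) of q[t]. *)
Definition cur (K : fieldType) (d : nat) (i : 'I_d) (f : {poly K}) :
    Sym K ('I_d * nat)%type :=
  \sum_(k < size f) f`_k *: svar K (i, k : nat).

(* In Sym K ('I_d * 'I_n), the basis of W: (i, k) stands for x_i \bar t^k,
   k < n; this is the class of x_i f(t) in q[t]/(p), for p monic of degree n. *)
Definition wcls (K : fieldType) (d n : nat) (p : {poly K}) (i : 'I_d)
    (f : {poly K}) : Sym K ('I_d * 'I_n)%type :=
  \sum_(k < n) (f %% p)`_k *: svar K (i, k).

Definition psi (K : fieldType) (d n : nat) (p : {poly K}) :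
    Sym K ('I_d * nat)%type -> Sym K ('I_d * 'I_n)%type :=
  shom (fun v => wcls n p v.1 'X^(v.2)).

(* [x_i \bar t^k, x_j \bar t^l]_p *)
Definition brW (K : fieldType) (q : vectType K) (br : q -> q -> q)
    (d : nat) (x : d.-tuple q) (n : nat) (p : {poly K})
    (u v : 'I_d * 'I_n) : Sym K ('I_d * 'I_n)%type :=
  \sum_(s < d) strcst br x u.1 v.1 s *: wcls n p s 'X^(u.2 + v.2).

Definition Zquo (K : fieldType) (q : vectType K) (br : q -> q -> q)
    (d : nat) (x : d.-tuple q) (n : nat) (p : {poly K})
    (F : Sym K ('I_d * 'I_n)%type) : Prop :=
  forall G, lie_poisson (brW br x p) F G = 0.

Definition Zpencil (K : fieldType) (q : vectType K) (br : q -> q -> q)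
    (d : nat) (x : d.-tuple q) (n : nat) (p1 p2 : {poly K}) :
    Sym K ('I_d * 'I_n)%type -> Prop :=
  subalg_gen (fun F => exists c : K, Zquo br x (c *: p1 + (1 - c) *: p2) F).

(* In Sym K ('I_d * nat) viewed as S(t^-1 q[t^-1]), (j, k) stands for
   x_j t^(-k-1).  This is the action of x_i t^m on x_j t^(-k-1), namely
   [x_i, x_j] t^(m-k-1) modulo q[t]. *)
Definition act_neg (K : fieldType) (q : vectType K) (br : q -> q -> q)
    (d : nat) (x : d.-tuple q) (i : 'I_d) (m : nat) (v : 'I_d * nat) :
    Sym K ('I_d * nat)%type :=
  if (m <= v.2)%N then
    \sum_(s < d) strcst br x i v.1 s *: svar K (s, v.2 - m)%N
  else 0.

(* Z(\hat q, t^-1) = S(t^-1 q[t^-1])^(q[t]) *)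
Definition Zhat (K : fieldType) (q : vectType K) (br : q -> q -> q)
    (d : nat) (x : d.-tuple q) (F : Sym K ('I_d * nat)%type) : Prop :=
  forall i m, sder (act_neg br x i m) F = 0.

(* The image of Z(\hat q, t^-1) under x t^(-k-1) |-> x (t+1)^(k+1). *)
Definition Zhat1 (K : fieldType) (q : vectType K) (br : q -> q -> q)
    (d : nat) (x : d.-tuple q) (G : Sym K ('I_d * nat)%type) : Prop :=
  exists2 F, Zhat br x F &
    G = shom (fun v => cur v.1 (('X + 1) ^+ v.2.+1)) F.

Definition tdeg (d : nat) (m : {cmonom ('I_d * nat)%type}) : nat :=
  (\sum_(v <- finsupp m) m v * v.2)%N.

Definition tcomp (K : fieldType) (d r : nat) (F : Sym K ('I_d * nat)%type) :
    Sym K ('I_d * nat)%type :=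
  \sum_(m <- msupp F | tdeg m == r) << F@_m *g m >>.

(* G is the nonzero homogeneous component of F of the least t-degree. *)
Definition lowest_tcomp (K : fieldType) (d : nat)
    (F G : Sym K ('I_d * nat)%type) : Prop :=
  exists r, [/\ G = tcomp r F, G != 0
              & forall s, (s < r)%N -> tcomp s F = 0].

Definition Zv (K : fieldType) (q : vectType K) (br : q -> q -> q)
    (d : nat) (x : d.-tuple q) : Sym K ('I_d * nat)%type -> Prop :=
  subalg_gen (fun G => exists2 F, Zhat1 br x F & lowest_tcomp F G).

(** ** Gaudin Hamiltonians *)

Definition rootpoly (K : fieldType) (n : nat) (a : 'I_n -> K) : {poly K} :=
  \prod_(i < n) ('X - (a i)%:P).

Definition rpoly (K : fieldType) (n : nat) (a : 'I_n -> K) (i : 'I_n) :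
    {poly K} :=
  (\prod_(j < n | j != i) (a i - a j)^-1)
    *: (rootpoly a %/ ('X - (a i)%:P)).

(* h[\bar f, \bar g] *)
Definition hW (K : fieldType) (d n : nat) (p f g : {poly K}) :
    Sym K ('I_d * 'I_n)%type :=
  \sum_(i < d) wcls n p i f * wcls n p i g.

Definition gaudin (K : fieldType) (d n : nat) (a z : 'I_n -> K) (k : 'I_n) :
    Sym K ('I_d * 'I_n)%type :=
  \sum_(j < n | j != k)
     (z k - z j)^-1 *: hW d n (rootpoly a) (rpoly a k) (rpoly a j).

(* Main.v *)
(** Write h[f, g] for the sum of the x_i f x_i g, extend h linearly to
    polynomials C(t, u), and let r_i be the Lagrange polynomials of the a_i.

    In q[t]/(p~) the element h[C] is central as soon as t C = u C modulo
    (p~(t), p~(u)), because the structure constants are totally antisymmetric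
    in an orthonormal basis.  For C = \sum c_ij r_i(t) r_j(u) and p~ = p + s
    this is the linear system
      (a_i - a_j) c_ij = s (\sum_l w_l c_lj - \sum_l w_l c_il), w_l = 1/p'(a_l),
    since t r_i = a_i r_i - s w_i modulo p~.  For s = 0 the h[r_j, r_j] are
    solutions; for s = 1 the coefficients of 2 H_k extend to a solution by a
    suitable diagonal.  Hence H_k lies in Z(p, p + 1).

    The sums of h[t^(-a), t^(-b)] over a + b = m are invariant under q[t], and
    their images combine to h[(1 + t)(1 + u)(t^m - u^m)/(t - u)], whose lowest
    component is h[(t^m - u^m)/(t - u)].  So Z_v contains
    h[(g(t) - g(u))/(t - u)] for every polynomial g.  For g = 3 r_k^2 - 2 r_k^3,
    which satisfies g(a_j) = (j == k) and g'(a_j) = 0, its image is 2 H_k. *)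

Require Import Defs.
From HB Require Import structures.
From mathcomp Require Import all_boot all_order all_algebra.
From mathcomp Require Import finmap monalg ring.

Set Implicit Arguments.
Unset Strict Implicit.
Unset Printing Implicit Defensive.

Import GRing.Theory.
Local Open Scope ring_scope.

(** * Evaluations and derivations of symmetric algebras *)

(** The Leibniz rule modulo t^2. The coefficients enter through equations, so that values already
    known in another form can be supplied directly. *)
Lemma coefM1 (R : nzRingType) (p q : {poly R}) (p0 p1 q0 q1 : R) :
  p`_0 = p0 -> p`_1 = p1 -> q`_0 = q0 -> q`_1 = q1 ->
  (p * q)`_1 = p1 * q0 + p0 * q1.
Proof.
by move=> <- <- <- <-; rewrite coefM big_ord_recl big_ord1 addrC.
Qed.

Section Evaluation.
Context (R : comNzRingType) (I : choiceType).
Implicit Types (h d : I -> R) (m : {cmonom I}).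

Lemma monevalEw h m (A : {fset I}) : (finsupp m `<=` A)%fset ->
  moneval h m = \prod_(v <- A) h v ^+ m v.
Proof.
move=> le; rewrite /moneval (big_fset_incl _ le) // => v _.
by rewrite memNfinsupp => /eqP ->; rewrite expr0.
Qed.

Lemma moneval_multiplicative h : mmorphism (moneval h).
Proof.
split=> [m1 m2|]; last by rewrite /moneval mdom1 big_seq_fset0.
rewrite /moneval mdomD -/(moneval h m1) -/(moneval h m2).
rewrite (monevalEw h (fsubsetUl _ (finsupp m2))).
rewrite (monevalEw h (fsubsetUr (finsupp m1) _)) -big_split /=.
by apply: eq_bigr => v _; rewrite cmM exprD.
Qed.

HB.instance Definition _ h :=
  isMultiplicative.Build {cmonom I} R (moneval h) (moneval_multiplicative h).

Lemma moneval_ucm h v : moneval h (ucm v) = h v.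
Proof. by rewrite /moneval mdomU big_seq_fset1 cmUU expr1. Qed.

Lemma deriv_prod (r : seq I) (f : I -> {poly R}) : uniq r ->
  (\prod_(v <- r) f v)^`() =
  \sum_(v <- r) (f v)^`() * \prod_(w <- r | w != v) f w.
Proof.
elim: r => [|u r IH] /=; first by rewrite !big_nil derivC.
case/andP=> ur /IH {}IH; rewrite !big_cons derivM IH eqxx /=; congr (_ + _).
  congr (_ * _); rewrite big_seq [RHS]big_seq_cond; apply: eq_bigl => w.
  by case wr: (w \in r) => //=; apply/esym; apply: contraNneq ur => <-.
rewrite mulr_sumr big_seq [RHS]big_seq; apply: eq_bigr => v vr.
rewrite big_cons ifT; last by apply: contraNneq ur => ->.
by rewrite mulrCA.
Qed.

Lemma moneval_dual0 h d m :
  (moneval (fun v => (h v)%:P + (d v)%:P * 'X) m)`_0 = moneval h m.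
Proof.
rewrite -horner_coef0 /moneval horner_prod; apply: eq_bigr => v _.
by rewrite horner_exp !hornerE.
Qed.

(** The coefficient of t is the value at 0 of the derivative in t, so the product rule yields the
    directional derivative of the monomial at [h] along [d]. *)
Lemma moneval_dual1 h d m :
  (moneval (fun v => (h v)%:P + (d v)%:P * 'X) m)`_1 =
  \sum_(v <- finsupp m) (moneval h (divcm m (ucm v)) * d v) *+ m v.
Proof.
have -> (p : {poly R}) : p`_1 = p^`().[0] by rewrite horner_coef0 coef_deriv.
rewrite /moneval deriv_prod // horner_sum big_seq [RHS]big_seq.
apply: eq_bigr => v vm; rewrite -/(moneval h _).
have le : (finsupp (divcm m (ucm v)) `<=` finsupp m)%fset.
  apply/fsubsetP => w; rewrite -!cmE_neq0 divcmE.
  by apply: contraNneq => ->.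
rewrite (monevalEw h le) (bigD1_seq v) //= divcmE ucmE eqxx subn1.
rewrite deriv_exp derivD derivC add0r derivM derivC mul0r add0r derivX mulr1.
rewrite hornerM hornerMn hornerM horner_prod hornerC horner_exp !hornerE.
set X := \prod_(_ <- _ | _) _; set Y := \prod_(_ <- _ | _) _.
suff -> : X = Y by rewrite mulrnAl [d v * _]mulrC mulrAC.
apply: eq_bigr => w wv.
by rewrite divcmE ucmE [v == w]eq_sym (negbTE wv) subn0 horner_exp !hornerE.
Qed.
End Evaluation.

Section Derivation.
Context (K : fieldType) (I : choiceType).
Implicit Types (D : I -> Sym K I) (F G : Sym K I).

Lemma mmap_svar (R : comNzRingType) (e : {rmorphism K -> R}) (h : I -> R) v :
  mmap e (moneval h) (svar K v) = h v.
Proof. by rewrite mmapU /= rmorph1 mul1r moneval_ucm. Qed.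

Lemma mmap_dual0 (R : comNzRingType) (e : {rmorphism K -> R}) (h d : I -> R) F :
  (mmap (polyC \o e) (moneval (fun v => (h v)%:P + (d v)%:P * 'X)) F)`_0 =
  mmap e (moneval h) F.
Proof.
rewrite !mmapE coef_sum; apply: eq_bigr => m _.
by rewrite coefCM moneval_dual0.
Qed.

(* Evaluation at [h + d t] modulo [t^2] turns derivations into morphisms. *)
Lemma mmap_dual1 (R : comNzRingType) (e : {rmorphism K -> R}) (h : I -> R)
    D (d : I -> R) F : (forall v, d v = mmap e (moneval h) (D v)) ->
  (mmap (polyC \o e) (moneval (fun v => (h v)%:P + (d v)%:P * 'X)) F)`_1 =
  mmap e (moneval h) (sder D F).
Proof.
move=> dE; rewrite mmapE coef_sum /sder raddf_sum; apply: eq_bigr => m _ /=.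
rewrite coefCM moneval_dual1 raddf_sum mulr_sumr; apply: eq_bigr => v _ /=.
by rewrite mmapZ rmorphM /= mmapU /= rmorph1 mul1r rmorphMn mulrnAl mulrnAr -dE.
Qed.

Definition smon (m : {cmonom I}) : Sym K I := << m >>.

Lemma smonM m1 m2 : smon (mmul m1 m2) = smon m1 * smon m2.
Proof. by rewrite [RHS]fgmulUU mulr1. Qed.

Lemma smon1 : smon mone = 1.
Proof. exact: mpolyC1E. Qed.

Lemma smonZ c m : c *: smon m = << c *g m >>.
Proof. by rewrite -mul_malgC [LHS]fgmulUU mulr1 mul1m. Qed.

Lemma smon_prod (r : seq I) (f : I -> {cmonom I}) :
  smon (\big[mmul/mone]_(v <- r) f v) = \prod_(v <- r) smon (f v).
Proof. exact: (big_morph _ smonM smon1). Qed.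

Lemma smonX v k : smon (iter k (mmul (ucm v)) mone) = svar K v ^+ k.
Proof.
elim: k => [|k IH]; first exact: smon1.
by rewrite iterS smonM IH exprS.
Qed.

(** Each monomial is rebuilt from its exponents. This specialises the evaluations at [h + d t] to
    the generic point. *)
Lemma mmap_id F : mmap (@malgC {cmonom I} K) (moneval (svar K)) F = F.
Proof.
rewrite mmapE [RHS]monalgE; apply: eq_bigr => m _.
rewrite mul_malgC /moneval.
under eq_bigr => v _ do rewrite -smonX.
rewrite -smon_prod; set m' := \big[_/_]_(_ <- _) _.
suff -> : m' = m.
  exact: smonZ.
apply/eqP/cmP => v; rewrite /m'.
rewrite (big_morph (fun m : {cmonom I} => m v) (op1 := addn) (id1 := 0%N));
  [| by move=> m1 m2; rewrite cmM | by rewrite cm1].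
have itE w k : iter k (mmul (ucm w)) mone v = ((w == v) * k)%N :> nat.
  by elim: k => [|k IH]; rewrite ?cm1 ?muln0 //= cmM IH ucmE mulnS.
under eq_bigr => w _ do rewrite itE.
case: (boolP (v \in finsupp m)) => vm.
  rewrite (bigD1_seq v) //= eqxx mul1n big1 ?addn0 // => w /negbTE ->.
  by rewrite mul0n.
have /eqP -> : m v == 0%N by rewrite -memNfinsupp in vm *.
rewrite big_seq big1 // => w wm; case: eqP => [wv|]; rewrite ?mul0n //.
by rewrite -wv wm in vm.
Qed.

(** Modulo t^2 this is the morphism F |-> F + t D(F). The Leibniz rule for [sder], which is defined
    monomial by monomial, is read off from its multiplicativity. *)
Definition dual D : Sym K I -> {poly Sym K I} :=
  mmap (polyC \o @malgC {cmonom I} K)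
    (moneval (fun v => (svar K v)%:P + (D v)%:P * 'X)).

HB.instance Definition _ D := GRing.RMorphism.on (dual D).

Lemma dual_coef0 D F : (dual D F)`_0 = F.
Proof. by rewrite /dual mmap_dual0 mmap_id. Qed.

Lemma dual_coef1 D F : (dual D F)`_1 = sder D F.
Proof.
rewrite /dual (mmap_dual1 (D := D)) ?mmap_id // => v.
by rewrite mmap_id.
Qed.

Lemma sder_svar D v : sder D (svar K v) = D v.
Proof.
rewrite -dual_coef1 /dual mmap_svar coefD coefC add0r coefCM coefX eqxx.
exact: mulr1.
Qed.

Lemma sderM D F G : sder D (F * G) = sder D F * G + F * sder D G.
Proof.
rewrite -(dual_coef1 D (F * G)).
have -> : dual D (F * G) = dual D F * dual D G by exact: rmorphM.
exact: coefM1 (dual_coef0 D F) (dual_coef1 D F)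
  (dual_coef0 D G) (dual_coef1 D G).
Qed.

Lemma dualZ D c F : dual D (c *: F) = (malgC c)%:P * dual D F.
Proof. exact: mmapZ. Qed.

Lemma sder_linear D : linear (sder D).
Proof.
move=> c F G; rewrite -[LHS]dual_coef1.
have -> : dual D (c *: F + G) = dual D (c *: F) + dual D G by exact: rmorphD.
rewrite coefD dualZ coefCM [X in _ * X + _]dual_coef1 [X in _ + X]dual_coef1.
by rewrite mul_malgC.
Qed.

HB.instance Definition _ D :=
  GRing.isLinear.Build K (Sym K I) (Sym K I) _ (sder D) (sder_linear D).

Lemma eq_sder D D' F : D =1 D' -> sder D F = sder D' F.
Proof.
by move=> eD; apply: eq_bigr => m _; apply: eq_bigr => v _; rewrite eD.
Qed.

Lemma sder_sumD (T : Type) (r : seq T) (D : T -> I -> Sym K I) F :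
  sder (fun u => \sum_(t <- r) D t u) F = \sum_(t <- r) sder (D t) F.
Proof.
rewrite /sder [RHS]exchange_big; apply: eq_bigr => m _ /=.
rewrite [RHS]exchange_big; apply: eq_bigr => v _ /=.
by rewrite mulr_sumr scaler_sumr.
Qed.

Lemma sder_mulD D E F : sder (fun u => E * D u) F = E * sder D F.
Proof.
rewrite /sder mulr_sumr; apply: eq_bigr => m _ /=.
rewrite mulr_sumr; apply: eq_bigr => v _ /=.
by rewrite -scalerAr mulrCA.
Qed.

(** A derivation depends S(V)-linearly on its values at the variables, so {F, G} is a combination of
    the {F, v} with the partial derivatives of G as coefficients. *)
Lemma lie_poisson_eq0 (b : I -> I -> Sym K I) F G :
  (forall v, sder (b^~ v) F = 0) -> lie_poisson b F G = 0.
Proof.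
move=> bF; rewrite /lie_poisson {2}/sder sder_sumD big1 // => m _.
rewrite sder_sumD big1 // => v _.
rewrite (@eq_sder _
  (fun u => ((G@_m *+ m v) *: << divcm m (ucm v) >>) * b u v)).
  by rewrite sder_mulD bF mulr0.
by move=> u; rewrite scalerAl.
Qed.
End Derivation.

Section Homomorphism.
Context (K : fieldType) (I J : choiceType).
Implicit Types (h : I -> Sym K J).

HB.instance Definition _ h :=
  GRing.RMorphism.copy (shom h) (mmap (@malgC {cmonom J} K) (moneval h)).

Lemma shomZ h c F : shom h (c *: F) = c *: shom h F.
Proof. by rewrite -[RHS]mul_malgC; exact: mmapZ. Qed.

HB.instance Definition _ h :=
  GRing.isScalable.Build K (Sym K I) (Sym K J) _ (shom h) (shomZ h).

Lemma shom_svar h v : shom h (svar K v) = h v.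
Proof. exact: mmap_svar. Qed.

Lemma mmap_shom (R : comNzRingType) (e : {rmorphism K -> R}) (g : J -> R) h F :
  mmap e (moneval g) (shom h F) =
  mmap e (moneval (fun v => mmap e (moneval g) (h v))) F.
Proof.
rewrite /shom [mmap malgC _ F]mmapE raddf_sum mmapE; apply: eq_bigr => m _ /=.
rewrite rmorphM /= mmapC [moneval h m]/moneval rmorph_prod; congr (_ * _).
by apply: eq_bigr => v _; rewrite rmorphXn.
Qed.

Lemma eq_mmap (R : comNzRingType) (e : K -> R) (g g' : I -> R) (F : Sym K I) :
  g =1 g' -> mmap e (moneval g) F = mmap e (moneval g') F.
Proof.
move=> eg; apply: eq_bigr => m _; congr (_ * _).
by apply: eq_bigr => v _; rewrite eg.
Qed.
End Homomorphism.

(** * Infinitesimal invariance of the form *)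

Lemma map_mx_conj (R S : comNzRingType) (f : {rmorphism R -> S}) (N : nat)
    (G A : 'M[R]_N) :
  map_mx f (G *m A *m \adj G) = map_mx f G *m map_mx f A *m \adj (map_mx f G).
Proof. by rewrite !map_mxM map_mx_adj. Qed.

Section Adjoint.
Context (K : fieldType) (N : nat).
Implicit Types (X g : 'M[K]_N) (f : Sym K ('I_N * 'I_N)%type).

(* f |-> f(1 + t X), as a polynomial in t. *)
Definition line1 X : Sym K ('I_N * 'I_N)%type -> {poly K} :=
  mmap (polyC \o idfun)
    (moneval (fun ij => (mxval 1%:M ij)%:P + (mxval X ij)%:P * 'X)).

HB.instance Definition _ X := GRing.RMorphism.on (line1 X).

Lemma line1_coef1 X f : (line1 X f)`_1 = diff1 X f.
Proof.
by apply: mmap_dual1 => ij; rewrite mmapC.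
Qed.

(** The coordinate functions of Y |-> g Y g^-1. *)
Definition conjvar g (ij : 'I_N * 'I_N) : Sym K ('I_N * 'I_N)%type :=
  \sum_k \sum_l (g ij.1 k * invmx g l ij.2) *: svar K (k, l).

Lemma mmap_conjvar (R : comNzRingType) (e : {rmorphism K -> R})
    (h : 'I_N * 'I_N -> R) g ij :
  mmap e (moneval h) (conjvar g ij) =
  (map_mx e g *m (\matrix_(k, l) h (k, l)) *m map_mx e (invmx g)) ij.1 ij.2.
Proof.
rewrite /conjvar raddf_sum mxE /=.
under eq_bigr => k _ do rewrite raddf_sum /=.
rewrite exchange_big; apply: eq_bigr => l _; rewrite !mxE mulr_suml.
apply: eq_bigr => k _; rewrite mmapZ mmap_svar !mxE rmorphM /=.
by rewrite mulrAC.
Qed.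

(** If f vanishes on Q, so does its composite with conjugation by g. Conjugation fixes the identity
    and is linear, so differentiating the composite along X differentiates f along g X g^-1. *)
Lemma tangent1_conj (Q : 'M[K]_N -> Prop) g X : algebraic_group Q -> Q g ->
  tangent1 Q X -> tangent1 Q (g *m X *m invmx g).
Proof.
case=> -[E QE] _ QM QV Qg tX f f0.
have gU : g \in unitmx by case/QE: (Qg).
have f'0 h : Q h -> seval (mxval h) (shom (conjvar g) f) = 0.
  move=> Qh; rewrite /seval mmap_shom.
  rewrite -(f0 (g *m h *m invmx g)).
    2: exact: (QM _ _ (QM _ _ Qg Qh) (QV _ Qg)).
  apply: eq_mmap => -[i j]; rewrite mmap_conjvar /mxval !map_mx_id //.
  by congr ((_ *m _ *m _) _ _); apply/matrixP => k l; rewrite mxE.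
rewrite -(tX _ f'0) -!line1_coef1 /line1 mmap_shom; congr ((polyseq _)`_1).
apply: eq_mmap => -[i j]; rewrite mmap_conjvar /=.
have -> : \matrix_(k, l) ((mxval 1%:M (k, l))%:P + (mxval X (k, l))%:P * 'X)
    = map_mx polyC 1%:M + 'X *: map_mx polyC X.
  by apply/matrixP => k l; rewrite mxE /mxval /= !mxE mulrC.
rewrite mulmxDr mulmxDl -scalemxAr -scalemxAl -!map_mxM mulmx1 mulmxV //.
by rewrite mxE /mxval /= !mxE mulrC.
Qed.

Lemma map_mx_coef1M (A B : 'M[{poly K}]_N) :
  map_mx (coefp 1) (A *m B) =
  map_mx (coefp 1) A *m map_mx (coefp 0) B
  + map_mx (coefp 0) A *m map_mx (coefp 1) B.
Proof.
apply/matrixP => i j; rewrite !mxE /= coef_sum -big_split.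
apply: eq_bigr => k _.
by rewrite (coefM1 (erefl _) (erefl _) (erefl _) (erefl _)) !mxE.
Qed.

Lemma map_mx_coef1C (A : 'M[K]_N) : map_mx (coefp 1) (map_mx polyC A) = 0.
Proof. by apply/matrixP => i j; rewrite !mxE /= coefC. Qed.

Lemma map_mx_coef0C (A : 'M[K]_N) : map_mx (coefp 0) (map_mx polyC A) = A.
Proof. by apply/matrixP => i j; rewrite !mxE /= coefC. Qed.

Definition genmx : 'M[Sym K ('I_N * 'I_N)%type]_N :=
  \matrix_(i, j) svar K (i, j).

(** At an invertible g this is det(g) Ad(g) U; the adjugate keeps it polynomial in the entries of
    g. *)
Definition adjvar (U : 'M[K]_N) := genmx *m map_mx malgC U *m \adj genmx.

Lemma map_adjvar (R : comNzRingType) (e : {rmorphism K -> R})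
    (h : 'I_N * 'I_N -> R) U :
  map_mx (mmap e (moneval h)) (adjvar U) =
  (\matrix_(i, j) h (i, j)) *m map_mx e U *m \adj (\matrix_(i, j) h (i, j)).
Proof.
have gE : map_mx (mmap e (moneval h)) genmx = \matrix_(i, j) h (i, j).
  by apply/matrixP => i j; rewrite !mxE mmap_svar.
rewrite /adjvar (map_mx_conj (mmap e (moneval h))).
congr (_ *m _ *m \adj _); [exact: gE | | exact: gE].
by apply/matrixP => i j; rewrite !mxE; exact: mmapC.
Qed.

(** First-order expansion of det(g) Ad(g) U along g = 1 + t X. The linear term of the determinant is
    left unevaluated because it cancels later; the existentials let later computations treat the
    matrices as variables. *)
Lemma line1_adjvar X : exists2 G, map_mx (line1 X) genmx = G &
  (\det G)`_0 = 1 /\ forall U,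
    exists2 M, map_mx (line1 X) (adjvar U) = M &
      map_mx (coefp 0) M = U /\
      map_mx (coefp 1) M = X *m U - U *m X + (\det G)`_1 *: U.
Proof.
set G := map_mx (line1 X) genmx; exists G => //.
have GE : G = map_mx polyC 1%:M + 'X *: map_mx polyC X.
  apply/matrixP => i j; rewrite !mxE /line1 mmap_svar.
  by rewrite /mxval /= !mxE mulrC.
have G0 : map_mx (coefp 0) G = 1%:M.
  by rewrite GE map_mxD map_mx_coef0C; apply/matrixP => i j;
     rewrite !mxE /= coefXM addr0.
have G1 : map_mx (coefp 1) G = X.
  by rewrite GE map_mxD map_mx_coef1C; apply/matrixP => i j;
     rewrite !mxE /= coefXM add0r coefC.
have D0 : (\det G)`_0 = 1 by rewrite -[LHS]/(coefp 0 _) -det_map_mx G0 det1.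
have A0 : map_mx (coefp 0) (\adj G) = 1%:M.
  have := congr1 (map_mx (coefp 0)) (mul_adj_mx G).
  by rewrite map_mxM G0 mulmx1 map_scalar_mx /= D0.
(* The coefficient of t in adj(G) G = det(G). *)
have A1 : map_mx (coefp 1) (\adj G) = ((\det G)`_1)%:M - X.
  have := congr1 (map_mx (coefp 1)) (mul_adj_mx G).
  have -> (c : {poly K}) : map_mx (coefp 1) (c%:M : 'M_N) = (c`_1)%:M.
    by apply/matrixP => i j; rewrite !mxE /= coefMn.
  by rewrite map_mx_coef1M G0 G1 A0 mulmx1 mul1mx => <-; rewrite addrK.
split=> // U; exists (G *m map_mx polyC U *m \adj G).
  rewrite /adjvar (map_mx_conj (line1 X)); congr (_ *m _ *m _).
  by apply/matrixP => i j; rewrite !mxE; exact: mmapC.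
split; first by rewrite !map_mxM G0 A0 map_mx_coef0C mul1mx mulmx1.
rewrite !map_mx_coef1M !map_mxM G0 A0 G1 A1 !map_mx_coef0C map_mx_coef1C.
by rewrite mulmx0 addr0 mulmx1 mul1mx mulmxBr mul_mx_scalar addrCA addrC.
Qed.
End Adjoint.

Section Invariance.
Context (K : fieldType) (N : nat) (Q : 'M[K]_N -> Prop).
Context (q : vectType K) (br : q -> q -> q) (phi : {linear q -> 'M[K]_N}).
Context (B : q -> q -> K) (d : nat) (x : d.-tuple q).
Hypotheses (hQ : algebraic_group Q) (hbr : lie_bracket br).
Hypotheses (hphi : lie_of_group Q br phi) (hB : quadratic_form Q phi B).
Hypothesis hx : orthonormal_basis B x.

Let form_basis u v : B u v = \sum_(s < d) coord x s v * B u (tnth x s).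
Proof.
have [Bl _ _ _] := hB; have [xb _] := hx.
rewrite {1}(coord_basis xb (memvf v)).
pose Bu : {scalar q} := HB.pack (B u) (GRing.isLinear.Build _ _ _ _ _ (Bl u)).
rewrite -[B _]/(Bu : q -> K) linear_sum; apply: eq_bigr => i _.
by rewrite linearZ /= -(tnth_nth 0).
Qed.

Lemma orthonormal_coord u s : B u (tnth x s) = coord x s u.
Proof.
have [_ Bs _ _] := hB; have [_ xo] := hx.
rewrite Bs form_basis (bigD1 s) // big1 => [|i si] /=.
  by rewrite xo eqxx mulr1 addr0.
by rewrite xo eq_sym (negbTE si) mulr0.
Qed.

Lemma orthonormal_form u v : B u v = \sum_(s < d) coord x s u * coord x s v.
Proof.
rewrite form_basis; apply: eq_bigr => s _.
by rewrite orthonormal_coord mulrC.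
Qed.

(** The s-th coordinate on the image of [phi], extended linearly to all matrices through a left
    inverse of [phi]. *)
Let lam (s : 'I_d) (M : 'M[K]_N) : K := coord x s ((linfun phi)^-1%VF M).

(** Base change of [lam] along [e], so that it applies to matrices of polynomials. *)
Let lamx (R : comNzRingType) (e : {rmorphism K -> R}) s (M : 'M[R]_N) : R :=
  \sum_i \sum_j e (lam s (delta_mx i j)) * M i j.

Let lamxE s M : lamx idfun s M = lam s M.
Proof.
rewrite /lam {2}(matrix_sum_delta M) !linear_sum; apply: eq_bigr => i _ /=.
by rewrite !linear_sum; apply: eq_bigr => j _ /=; rewrite !linearZ mulrC.
Qed.

Let lam_phi s u : lam s (phi u) = coord x s u.
Proof.
have [phiI _ _] := hphi; rewrite /lam.
rewrite -[phi u](lfunE phi) lker0_lfunK //; apply/lker0P => v w.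
by rewrite !lfunE; apply: phiI.
Qed.

Let lamZ_phi s c u : lam s (c *: phi u) = c * coord x s u.
Proof. by rewrite /lam !linearZ; congr (_ * _); exact: lam_phi. Qed.

Let lamx_map (R S : comNzRingType) (e : {rmorphism K -> R})
  (f : {rmorphism R -> S}) (g : {rmorphism K -> S}) s M : f \o e =1 g ->
  f (lamx e s M) = lamx g s (map_mx f M).
Proof.
move=> fe; rewrite /lamx rmorph_sum; apply: eq_bigr => i _.
rewrite rmorph_sum; apply: eq_bigr => j _.
by rewrite rmorphM mxE -fe.
Qed.

(* The factor det(g)^2 clears the denominators of the two inverses of g in
   B(Ad(g) u, Ad(g) v) - B(u, v). *)
Let defect u v : Sym K ('I_N * 'I_N)%type :=
  \sum_(s < d) lamx malgC s (adjvar (phi u)) * lamx malgC s (adjvar (phi v))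
  - (\det (genmx K N)) ^+ 2 * (B u v)%:MP.

Let mmap_defect (R : comNzRingType) (e : {rmorphism K -> R})
    (h : 'I_N * 'I_N -> R) u v (E := mmap e (moneval h)) G U V :
  map_mx E (genmx K N) = G -> map_mx E (adjvar (phi u)) = U ->
  map_mx E (adjvar (phi v)) = V ->
  E (defect u v) =
  \sum_(s < d) lamx e s U * lamx e s V - (\det G) ^+ 2 * e (B u v).
Proof.
move=> <- <- <-; rewrite /defect /E rmorphB rmorph_sum; congr (_ - _).
  apply: eq_bigr => s _; rewrite rmorphM; congr (_ * _);
  by apply: lamx_map => c /=; exact: mmapC.
rewrite rmorphM rmorphXn; congr (_ ^+ 2 * _); last exact: mmapC.
exact/esym/det_map_mx.
Qed.

(** Group invariance makes [defect u v] vanish on Q, so its differential at the identity kills the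
    tangent vector [phi w]. That differential is the left-hand side. *)
Lemma ad_invariant w u v : B (br w u) v + B u (br w v) = 0.
Proof.
have [_ tQ phi_br] := hphi; have [_ _ _ Binv] := hB.
have def0 g : Q g -> seval (mxval g) (defect u v) = 0.
  move=> Qg; have [[E QE] _ _ _] := hQ; have gU : g \in unitmx by case/QE: (Qg).
  (* Group invariance only concerns vectors whose images under Ad(g) come from q, so Ad(g) has to
     preserve the image of [phi]. *)
  have Ad z : exists z', phi z' = g *m phi z *m invmx g.
    by apply/tQ; apply: tangent1_conj => //; apply/tQ; exists z.
  have [[u' u'E] [v' v'E]] := (Ad u, Ad v).
  have gE : \matrix_(i, j) mxval g (i, j) = g.
    by apply/matrixP => i j; rewrite mxE.
  have adjE z z' : phi z' = g *m phi z *m invmx g ->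
      map_mx (mmap idfun (moneval (mxval g))) (adjvar (phi z)) =
      \det g *: phi z'.
    rewrite map_adjvar gE map_mx_id // => ->.
    by rewrite /invmx gU -!scalemxAr scalerA divff ?scale1r // -unitfE.
  rewrite /seval (@mmap_defect _ _ _ _ _ g _ _ _ (adjE _ _ u'E) (adjE _ _ v'E)).
    rewrite /= -(Binv g u v u' v') // orthonormal_form mulr_sumr -sumrB.
    rewrite big1 // => s _; rewrite !lamxE !lamZ_phi.
    by rewrite /= expr2 mulrACA subrr.
  by rewrite -[RHS]gE; apply/matrixP => i j; rewrite !mxE; exact: mmap_svar.
have : diff1 (phi w) (defect u v) = 0.
  have tw : tangent1 Q (phi w) by apply/tQ; exists w.
  exact: tw def0.
have [G GE [G0 line1_adj]] := line1_adjvar (phi w).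
have [U UE [U0 U1]] := line1_adj (phi u).
have [V VE [V0 V1]] := line1_adj (phi v).
rewrite -line1_coef1 /line1 (mmap_defect GE UE VE) /=.
have lamx0 s (M : 'M[{poly K}]_N) :
    (lamx (polyC \o idfun) s M)`_0 = lam s (map_mx (coefp 0) M).
  rewrite -lamxE /lamx coef_sum; apply: eq_bigr => i _.
  by rewrite coef_sum; apply: eq_bigr => j _; rewrite coefCM !mxE.
have lamx1 s (M : 'M[{poly K}]_N) :
    (lamx (polyC \o idfun) s M)`_1 = lam s (map_mx (coefp 1) M).
  rewrite -lamxE /lamx coef_sum; apply: eq_bigr => i _.
  by rewrite coef_sum; apply: eq_bigr => j _; rewrite coefCM !mxE.
have lamU s : lam s (map_mx (coefp 1) U) =
    coord x s (br w u) + (\det G)`_1 * coord x s u.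
  by rewrite U1 -phi_br -linearZ -linearD lam_phi !linearE.
have lamV s : lam s (map_mx (coefp 1) V) =
    coord x s (br w v) + (\det G)`_1 * coord x s v.
  by rewrite V1 -phi_br -linearZ -linearD lam_phi !linearE.
(* Each of the two factors in the sum contributes the linear term of det(G) times [B u v]; the
   square of the determinant contributes twice the same amount, and these terms cancel. *)
rewrite coefB coef_sum coefMC expr2 (coefM1 G0 erefl G0 erefl) mulr1 mul1r.
under eq_bigr => s _ do
  rewrite (coefM1 (lamx0 s U) (lamx1 s U) (lamx0 s V) (lamx1 s V))
    U0 V0 !lam_phi lamU lamV mulrDl mulrDr addrACA.
rewrite !big_split /= => <-; rewrite !orthonormal_form.
rewrite mulrDl mulr_sumr.
under [X in _ = _ + (X + _) - _]eq_bigr => s _ do rewrite -mulrA.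
under [X in _ = _ + (_ + X) - _]eq_bigr => s _ do rewrite mulrCA.
by rewrite addrK.
Qed.

(** In an orthonormal basis the structure constant is B([x_i, x_j], x_s), and invariance moves the
    action of x_i to the other argument. *)
Lemma strcst_skew i j s : strcst br x i j s = - strcst br x i s j.
Proof.
have := ad_invariant (tnth x i) (tnth x j) (tnth x s).
have [_ Bs _ _] := hB; rewrite [B (tnth x j) _]Bs !orthonormal_coord.
by move/eqP; rewrite addr_eq0 => /eqP.
Qed.

Lemma strcst_swap i j s : strcst br x i j s = - strcst br x j i s.
Proof.
have [brl brr br0 _] := hbr; rewrite /strcst -linearN /=; congr (coord x s _).
have brD u v w : br u (v + w) = br u v + br u w.
  by have := brl u 1 v w; rewrite !scale1r.
have Dbr u v w : br (v + w) u = br v u + br w u.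
  by have := brr u 1 v w; rewrite !scale1r.
have := br0 (tnth x i + tnth x j); rewrite brD !Dbr !br0 add0r addr0.
by rewrite addrC => /eqP; rewrite addr_eq0 => /eqP.
Qed.
End Invariance.

(** * Quadratic Casimirs and the Poisson pencil *)

(** A skew array paired with a symmetric one. Exchanging the indices in one half gives the opposite
    of the other half, so no division by 2 enters. *)
Lemma skew_sum (K : fieldType) (V : lmodType K) (d : nat)
    (c : 'I_d -> 'I_d -> K) (G : 'I_d -> 'I_d -> V) :
  (forall i s, c i s = - c s i) ->
  \sum_i \sum_s c i s *: (G s i + G i s) = 0.
Proof.
move=> cN; transitivity (\sum_i \sum_s c i s *: G s i
  + \sum_i \sum_s c i s *: G i s).
  rewrite -big_split; apply: eq_bigr => i _; rewrite -big_split.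
  by apply: eq_bigr => s _; rewrite scalerDr.
apply/eqP; rewrite addr_eq0 [X in - X]exchange_big -sumrN; apply/eqP.
apply: eq_bigr => i _; rewrite -sumrN; apply: eq_bigr => s _.
by rewrite (cN i s) scaleNr.
Qed.

Lemma sderM_sum (K : fieldType) (I : choiceType) (D : I -> Sym K I) (d : nat)
    (F G : Sym K I) (c : 'I_d -> K) (F' G' : 'I_d -> Sym K I) :
  sder D F = \sum_s c s *: F' s -> sder D G = \sum_s c s *: G' s ->
  sder D (F * G) = \sum_s c s *: (F' s * G + F * G' s).
Proof.
move=> DF DG; rewrite sderM DF DG mulr_suml mulr_sumr -big_split.
by apply: eq_bigr => s _ /=; rewrite scalerDr -scalerAl -scalerAr.
Qed.

Section Quotient.
Context (K : fieldType) (d n : nat) (p : {poly K}).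
Hypothesis size_p : size p = n.+1.

Lemma wcls_linear i : linear (@wcls K d n p i).
Proof.
move=> c f g; rewrite /wcls scaler_sumr -big_split; apply: eq_bigr => k _ /=.
by rewrite modpD modpZl coefD coefZ scalerDl scalerA.
Qed.

HB.instance Definition _ i :=
  GRing.isLinear.Build K {poly K} (Sym K ('I_d * 'I_n)%type) _
    (@wcls K d n p i) (wcls_linear i).

Local Notation W := (@wcls K d n p).

Lemma wcls_eq i f g : f %% p = g %% p -> W i f = W i g.
Proof. by rewrite /wcls => ->. Qed.

Lemma size_modp_le f : (size (f %% p)%R <= n)%N.
Proof. by rewrite -ltnS -size_p ltn_modp -size_poly_gt0 size_p. Qed.

Lemma poly_sumX (f : {poly K}) : (size f <= n)%N ->
  f = \sum_(k < n) f`_k *: 'X^k.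
Proof.
move=> fn; rewrite -poly_def; apply/polyP => k; rewrite coef_poly.
by case: ltnP => // nk; rewrite nth_default // (leq_trans fn).
Qed.

Context (q : vectType K) (br : q -> q -> q) (x : d.-tuple q).

(** Reduction modulo p is compatible with multiplication by t^l, so the bracket of classes is the
    class of the bracket in q[t]. *)
Lemma sder_wcls j l i f :
  sder (fun u => brW br x p u (j, l)) (W i f) =
  \sum_(s < d) strcst br x i j s *: W s ('X^l * f).
Proof.
rewrite {1}/wcls linear_sum /=.
under eq_bigr => k _ do rewrite linearZ /= sder_svar /brW /= scaler_sumr.
rewrite exchange_big; apply: eq_bigr => s _ /=.
have <- : \sum_(k < n) (f %% p)`_k *: W s 'X^(k + l) = W s ('X^l * f).
  rewrite -(@wcls_eq s ('X^l * (f %% p))); last by rewrite modp_mul.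
  rewrite {2}(poly_sumX (size_modp_le f)) mulr_sumr linear_sum.
  by apply: eq_bigr => k _; rewrite -scalerAr linearZ addnC exprD.
by rewrite [RHS]scaler_sumr; apply: eq_bigr => k _; rewrite !scalerA mulrC.
Qed.

Lemma sder_wclsM j l i f g :
  sder (fun u => brW br x p u (j, l)) (W i f * W i g) =
  \sum_(s < d) strcst br x i j s *:
    (W s ('X^l * f) * W i g + W i f * W s ('X^l * g)).
Proof.
exact: (sderM_sum (sder_wcls j l i f) (sder_wcls j l i g)).
Qed.

Context (m : nat) (r : 'I_m -> {poly K}) (C : 'M[K]_m).
(** The image of f(t) g(u) C(t, u), for C the sum of the C_ab r_a(t) r_b(u), with x_s attached to t
    and x_i to u. *)
Let T s i f g : Sym K ('I_d * 'I_n)%type :=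
  \sum_a \sum_b C a b *: (W s (f * r a) * W i (g * r b)).

(** The second hypothesis says t C = u C, hence t^l C = u^l C. Bracketing with x_j t^l then pairs
    the structure constants with an expression symmetric in i and s, whereas they are skew in these
    indices. *)
Lemma casimir_Zquo :
  (forall i j s, strcst br x i j s = - strcst br x s j i) ->
  (forall s i f g, T s i ('X * f) g = T s i f ('X * g)) ->
  Zquo br x p (\sum_i \sum_a \sum_b C a b *: (W i (r a) * W i (r b))).
Proof.
move=> skew TX G; apply: lie_poisson_eq0 => -[j l].
have TXn s i k : T s i 'X^k 1 = T s i 1 'X^k.
  suff gen f g : T s i ('X^k * f) g = T s i f ('X^k * g).
    by have := gen 1 1; rewrite !mulr1.
  elim: k f g => [|k IH] f g; first by rewrite expr0 !mul1r.
  by rewrite exprS -!mulrA TX IH mulrCA.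
rewrite linear_sum /= -[RHS](skew_sum (c := fun i s => strcst br x i j s)
  (fun s i => T s i 'X^l 1)) //; apply: eq_bigr => i _.
rewrite linear_sum /=.
under eq_bigr => a _ do rewrite linear_sum /=.
under eq_bigr => a _ do under eq_bigr => b _ do
  rewrite linearZ /= sder_wclsM [C a b *: _]scaler_sumr.
under eq_bigr => a _ do rewrite exchange_big /=.
rewrite exchange_big /=; apply: eq_bigr => s _.
rewrite (TXn i s) /T -big_split [RHS]scaler_sumr; apply: eq_bigr => a _ /=.
rewrite -big_split [RHS]scaler_sumr; apply: eq_bigr => b _ /=.
by rewrite !mul1r -scalerDr !scalerA mulrC.
Qed.
End Quotient.

(** * Lagrange interpolation at the roots of p *)

Section Lagrange.
Context (K : fieldType) (n : nat) (a : 'I_n -> K).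
Hypothesis ha : injective a.

(** The barycentric weight 1/p'(a_i). *)
Definition lweight (i : 'I_n) : K := \prod_(j < n | j != i) (a i - a j)^-1.

Lemma lweight_neq0 i : lweight i != 0.
Proof.
apply/prodf_neq0 => j ji; rewrite invr_neq0 // subr_eq0.
by apply: contra_neq ji => /ha.
Qed.

Lemma size_rootpoly : size (rootpoly a) = n.+1.
Proof.
by rewrite /rootpoly size_prod_XsubC [index_enum _]unlock -enumT size_enum_ord.
Qed.

Lemma rpolyE i :
  rpoly a i = lweight i *: \prod_(j < n | j != i) ('X - (a j)%:P).
Proof.
rewrite /rpoly -/(lweight i) /rootpoly (bigD1 i) //=.
by rewrite mulKp ?polyXsubC_eq0.
Qed.

Lemma mulXsubC_rpoly i :
  ('X - (a i)%:P) * rpoly a i = lweight i *: rootpoly a.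
Proof. by rewrite rpolyE -scalerAr /rootpoly [in RHS](bigD1 i). Qed.

Lemma size_rpoly i : (size (rpoly a i) <= n)%N.
Proof.
have r0 : rpoly a i != 0.
  rewrite rpolyE scaler_eq0 negb_or lweight_neq0 monic_neq0 //.
  exact: monic_prod_XsubC.
have := congr1 (fun p : {poly K} => size p) (mulXsubC_rpoly i).
rewrite size_monicM ?monicXsubC // size_XsubC.
rewrite (size_scale (rootpoly a) (lweight_neq0 i)) size_rootpoly.
by rewrite add2n => -[->].
Qed.

Lemma horner_rpoly i j : (rpoly a i).[a j] = (i == j)%:R.
Proof.
rewrite rpolyE hornerZ horner_prod; case: (eqVneq i j) => [<-|ij].
  rewrite /lweight -big_split big1 //= => k ki.
  rewrite !hornerE mulVf // subr_eq0.
  by apply: contra_neq ki => /ha.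
by rewrite [X in _ * X](bigD1 j) 1?eq_sym //= hornerXsubC subrr mul0r mulr0.
Qed.

(** The difference of the two sides has degree below n and vanishes at n distinct points. *)
Lemma lagrange_interp (f : {poly K}) : (size f <= n)%N ->
  f = \sum_i f.[a i] *: rpoly a i.
Proof.
move=> fn; apply/eqP; rewrite -subr_eq0; set g := _ - _.
have gn : (size g <= n)%N.
  apply: (leq_trans (size_polyD _ _)); rewrite geq_max fn size_polyN.
  apply: (leq_trans (size_sum _ _ _)); apply/bigmax_leqP => i _.
  exact: leq_trans (size_scale_leq _ _) (size_rpoly i).
apply: contraT => g0; have := @max_poly_roots _ g (codom a) g0.
rewrite size_codom card_ord ltnNge gn => h; apply: h.
  apply/allP => _ /codomP[j ->]; rewrite rootE /g hornerD hornerN horner_sum.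
  rewrite (bigD1 j) //= big1 => [|i ij]; rewrite hornerZ horner_rpoly.
    by rewrite eqxx mulr1 addr0 subrr.
  by rewrite (negbTE ij) mulr0.
by rewrite map_inj_uniq // enum_uniq.
Qed.

Lemma sum_rpoly : (0 < n)%N -> \sum_i rpoly a i = 1.
Proof.
move=> n0; rewrite [RHS]lagrange_interp ?size_poly1 //.
by apply: eq_bigr => i _; rewrite hornerC scale1r.
Qed.

Lemma modp_rootpoly (f : {poly K}) :
  f %% rootpoly a = \sum_i f.[a i] *: rpoly a i.
Proof.
rewrite [LHS]lagrange_interp; last exact: size_modp_le size_rootpoly f.
apply: eq_bigr => i _; congr (_ *: _).
rewrite [in RHS](divp_eq f (rootpoly a)) hornerD hornerM.
suff -> : (rootpoly a).[a i] = 0 by rewrite mulr0 add0r.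
by rewrite /rootpoly horner_prod (bigD1 i) //= hornerXsubC subrr mul0r.
Qed.
End Lagrange.

(** The vectors a_i U_i - s w_i (sum of the U_l) are what multiplication by t makes of the r_i
    modulo p + s. Comparing the coefficients of U_i V_j on both sides gives exactly the
    hypothesis. *)
Lemma tensor_transfer (K : fieldType) (A : comAlgType K) (n : nat)
    (a w : 'I_n -> K) (s : K) (C : 'M[K]_n) (U V : 'I_n -> A) :
  (forall i j, (a i - a j) * C i j =
     s * (\sum_l w l * C l j - \sum_l w l * C i l)) ->
  \sum_i \sum_j C i j *: ((a i *: U i - (s * w i) *: \sum_l U l) * V j) =
  \sum_i \sum_j C i j *: (U i * (a j *: V j - (s * w j) *: \sum_l V l)).
Proof.
move=> CE.
have lhsE :
    \sum_i \sum_j C i j *: ((a i *: U i - (s * w i) *: \sum_l U l) * V j) =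
    \sum_i \sum_j (a i * C i j - s * \sum_l w l * C l j) *: (U i * V j).
  under [RHS]eq_bigr do under eq_bigr do rewrite scalerBl.
  under [RHS]eq_bigr do rewrite sumrB.
  under [LHS]eq_bigr do under eq_bigr do rewrite mulrBl scalerBr.
  under [LHS]eq_bigr do rewrite sumrB.
  rewrite !sumrB; congr (_ - _).
    apply: eq_bigr => i _; apply: eq_bigr => j _.
    by rewrite -scalerAl scalerA mulrC.
  rewrite exchange_big [RHS]exchange_big; apply: eq_bigr => j _ /=.
  under eq_bigr do rewrite -scalerAl scalerA.
  rewrite -scaler_suml mulr_suml scaler_sumr; apply: eq_bigr => l _.
  congr (_ *: _); rewrite mulr_sumr; apply: eq_bigr => i _.
  by rewrite mulrC mulrA.
rewrite lhsE.
have -> : \sum_i \sum_j C i j *: (U i * (a j *: V j - (s * w j) *: \sum_l V l))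
    = \sum_i \sum_j (a j * C i j - s * \sum_l w l * C i l) *: (U i * V j).
  apply: eq_bigr => i _.
  under [RHS]eq_bigr do rewrite scalerBl.
  under [LHS]eq_bigr do rewrite mulrBr scalerBr.
  rewrite !sumrB; congr (_ - _).
    by apply: eq_bigr => j _; rewrite -scalerAr scalerA mulrC.
  under eq_bigr do rewrite -scalerAr scalerA.
  rewrite -scaler_suml [U i * _]mulr_sumr scaler_sumr; apply: eq_bigr => l _.
  congr (_ *: _); rewrite mulr_sumr; apply: eq_bigr => j _.
  by rewrite mulrC mulrA.
apply: eq_bigr => i _; apply: eq_bigr => j _; congr (_ *: _).
have := CE i j; rewrite mulrBl mulrBr => E.
apply: (addIr (s * \sum_l w l * C l j)); rewrite subrK -addrA.
by rewrite [- _ + _]addrC -E addrC subrK.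
Qed.

(** * Central quadratic elements for p + s *)

Section Pencil.
Context (K : fieldType) (n : nat) (a : 'I_n -> K).
Hypotheses (ha : injective a) (n_gt0 : (0 < n)%N).

Lemma size_rootpolyD s : size (rootpoly a + s%:P) = n.+1.
Proof.
rewrite size_polyDl size_rootpoly // ltnS.
exact: leq_trans (size_polyC_leq1 s) n_gt0.
Qed.

(** From (t - a_i) r_i = w_i p = w_i (p + s) - s w_i, where 1 is written as the sum of the r_l to
    stay in their span. *)
Lemma mulX_rpoly s i :
  'X * rpoly a i = a i *: rpoly a i - (s * lweight a i) *: \sum_l rpoly a l
                   + lweight a i *: (rootpoly a + s%:P).
Proof.
rewrite (sum_rpoly ha n_gt0) scalerDr -(mulXsubC_rpoly a i) mulrBl mul_polyC.
rewrite -[s%:P]alg_polyC [_ *: s%:A]scalerA [lweight a i * s]mulrC.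
by rewrite [RHS]addrC -addrA [X in _ + X]addrC subrK subrK.
Qed.

Context (q : vectType K) (br : q -> q -> q) (d : nat) (x : d.-tuple q).
Hypothesis skew : forall i j s, strcst br x i j s = - strcst br x s j i.

Definition casimir (C : 'M[K]_n) : Sym K ('I_d * 'I_n)%type :=
  \sum_(i < d) \sum_k \sum_l C k l *:
    (wcls n (rootpoly a) i (rpoly a k) * wcls n (rootpoly a) i (rpoly a l)).

(** The r_k have degree below n, so no reduction takes place: one element of S(W) can be tested
    against every bracket of the pencil. *)
Lemma wcls_rpoly (p : {poly K}) i k : size p = n.+1 ->
  wcls n p i (rpoly a k) = wcls n (rootpoly a) i (rpoly a k)
  :> Sym K ('I_d * 'I_n)%type.
Proof.
by move=> np; rewrite /wcls !modp_small ?np ?size_rootpoly // ltnS size_rpoly.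
Qed.

Lemma casimir_pencil s (C : 'M[K]_n) :
  (forall i j, (a i - a j) * C i j =
     s * (\sum_l lweight a l * C l j - \sum_l lweight a l * C i l)) ->
  Zquo br x (rootpoly a + s%:P) (casimir C).
Proof.
move=> CE; set p := _ + _; have size_p := size_rootpolyD s.
have -> : casimir C = \sum_(i < d) \sum_k \sum_l C k l *:
    (wcls n p i (rpoly a k) * wcls n p i (rpoly a l)).
  apply: eq_bigr => i _; apply: eq_bigr => k _; apply: eq_bigr => l _.
  by rewrite !(wcls_rpoly _ _ size_p).
apply: (@casimir_Zquo K d n p size_p q br x n (rpoly a) C skew) => u v f g.
(* Multiplication by t on the span of the r_k, the multiple of p being killed. The factor h carries
   whatever has already been multiplied in. *)
have WX t h k : wcls n p t ('X * h * rpoly a k) =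
    a k *: wcls n p t (h * rpoly a k)
    - (s * lweight a k) *: \sum_l wcls n p t (h * rpoly a l)
    :> Sym K ('I_d * 'I_n)%type.
  set g' := h * rpoly a k; set c := s * lweight a k.
  transitivity (wcls n p t
    (a k *: g' - c *: \sum_l (h * rpoly a l)) : Sym K ('I_d * 'I_n)%type).
    apply: wcls_eq; rewrite -mulrA mulrCA (mulX_rpoly s) mulrDr mulrBr.
    rewrite -[h * (a k *: _)]scalerAr -[h * (c *: _)]scalerAr.
    rewrite -[h * (lweight a k *: (_ + _))]scalerAr [h * \sum_l _]mulr_sumr.
    by rewrite modpD [(lweight a k *: _) %% p]modpZl modp_mull scaler0 addr0.
  rewrite [LHS]linearB [X in X - _ = _]linearZ [X in _ - X = _]linearZ.
  by rewrite [X in _ - _ *: X = _]linear_sum.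
under [LHS]eq_bigr => k _ do under eq_bigr => l _ do rewrite WX.
under [RHS]eq_bigr => k _ do under eq_bigr => l _ do rewrite WX.
exact: (@tensor_transfer _ _ _ a (lweight a) s C
  (fun k => wcls n p u (f * rpoly a k)) (fun l => wcls n p v (g * rpoly a l))).
Qed.
End Pencil.

(** * Gaudin Hamiltonians in the pencil subalgebra *)

Section Gaudin.
Context (K : fieldType) (d n : nat) (a : 'I_n -> K).

Lemma casimir_linear : linear (@casimir K n a d).
Proof.
move=> c C D; rewrite /casimir [c *: \sum_(_ < d) _]scaler_sumr -big_split.
apply: eq_bigr => i _; rewrite [c *: \sum_(_ < n) _]scaler_sumr -big_split.
apply: eq_bigr => k _; rewrite [c *: \sum_(_ < n) _]scaler_sumr -big_split.
apply: eq_bigr => l _.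
by rewrite mxE mxE [in LHS]scalerDl -[in LHS]scalerA.
Qed.

HB.instance Definition _ :=
  GRing.isLinear.Build K 'M[K]_n (Sym K ('I_d * 'I_n)%type) _
    (@casimir K n a d) casimir_linear.

Lemma casimir_tr (C : 'M[K]_n) : casimir a d C^T = casimir a d C.
Proof.
rewrite /casimir; apply: eq_bigr => i _.
rewrite [LHS]exchange_big; apply: eq_bigr => k _; apply: eq_bigr => l _.
by rewrite mxE [X in _ *: X = _]mulrC.
Qed.

(* The diagonal entries are 0 / 0 = 0. *)
Definition gaudinmx (k : 'I_n) : 'M[K]_n :=
  \matrix_(i, j) (((i == k)%:R - (j == k)%:R) / (a i - a j)).

Lemma casimir_gaudinmx k : casimir a d (gaudinmx k) = gaudin d a a k *+ 2.
Proof.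
(* Only row k of A is nonzero, and it holds the coefficients of H_k; transposition does not change
   the associated element, whence the factor 2. *)
pose A : 'M[K]_n := \matrix_(i, j) ((i == k)%:R / (a i - a j)).
have -> : gaudinmx k = A + A^T.
  apply/matrixP => i j; rewrite !mxE mulrBl; congr (_ + _).
  by rewrite -mulrN -invrN opprB.
rewrite [LHS]linearD [X in _ + X]casimir_tr -[LHS]mulr2n; congr (_ *+ 2).
rewrite /casimir /gaudin /hW.
under [RHS]eq_bigr do rewrite scaler_sumr.
rewrite [RHS]exchange_big; apply: eq_bigr => i _.
rewrite [LHS](bigD1 k) // [X in _ + X = _]big1 => [|j jk]; last first.
  by apply: big1 => l _; rewrite !mxE (negbTE jk) mul0r scale0r.
rewrite addr0 [LHS](bigD1 k) // mxE subrr invr0 mulr0 scale0r [LHS]add0r.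
by apply: eq_bigr => j jk; rewrite mxE eqxx mul1r.
Qed.

Lemma gaudinmx_pencil k (ha : injective a) :
  exists c : 'rV[K]_n, forall i j (C := gaudinmx k + diag_mx c),
    (a i - a j) * C i j =
      1 * (\sum_l lweight a l * C l j - \sum_l lweight a l * C i l).
Proof.
pose w := lweight a.
(* Solves w_j c_j + (sum over l of w_l times entry (l, j) of [gaudinmx k]) = - (j == k). By symmetry
   the weighted row sums take the same values, and their differences are the numerators in
   [gaudinmx k]. *)
pose c := \row_j ((w j)^-1 *
  (- (j == k)%:R - \sum_l w l * gaudinmx k l j)).
have sym i j : gaudinmx k i j = gaudinmx k j i.
  by rewrite !mxE -[in LHS]opprB -[a i - a j]opprB invrN mulrNN.
exists c => i j C.
have colE l : \sum_m w m * C m l = - (l == k)%:R.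
  under eq_bigr do rewrite mxE mulrDr.
  rewrite big_split /= [X in _ + X](bigD1 l) // [X in _ + (_ + X)]big1.
    rewrite !mxE eqxx mulr1n addr0 mulrA divff ?mul1r ?lweight_neq0 //.
    by rewrite addrC subrK.
  by move=> m ml; rewrite !mxE (negbTE ml) mulr0n mulr0.
have rowE l : \sum_m w m * C l m = - (l == k)%:R.
  rewrite -colE; apply: eq_bigr => m _; congr (_ * _).
  rewrite /C [LHS]mxE [RHS]mxE sym; congr (_ + _).
  rewrite [LHS]mxE [RHS]mxE [m == l]eq_sym.
  by case: (eqVneq l m) => [-> //|_]; rewrite !mulr0n.
rewrite colE rowE mul1r opprK [RHS]addrC !mxE.
case: (eqVneq i j) => [->|ij]; first by rewrite !subrr mul0r.
by rewrite mulr0n addr0 mulrC divfK // subr_eq0; apply: contra_neq ij => /ha.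
Qed.

Lemma subalg_gen_scale (A : algType K) (S : A -> Prop) (c : K) f :
  subalg_gen S f -> subalg_gen S (c *: f).
Proof.
move=> Sf; rewrite -mulr_algl.
exact: subalg_gen_mul (subalg_gen_scal _ _) Sf.
Qed.

Lemma subalg_gen_sum (A : algType K) (S : A -> Prop) (I : Type) (r : seq I)
    (F : I -> A) :
  (forall i, subalg_gen S (F i)) -> subalg_gen S (\sum_(i <- r) F i).
Proof.
move=> SF; apply: (big_ind (subalg_gen S)) => //.
  by rewrite -(scale0r 1); apply: subalg_gen_scal.
by move=> f g; apply: subalg_gen_add.
Qed.

Lemma gaudin_Zpencil (char0 : [pchar K] =i pred0) (ha : injective a)
    (n_gt0 : (0 < n)%N)
    (q : vectType K) (br : q -> q -> q) (x : d.-tuple q)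
    (skew : forall i j s, strcst br x i j s = - strcst br x s j i) k :
  Zpencil br x (rootpoly a) (rootpoly a + 1) (gaudin d a a k).
Proof.
have [c cE] := gaudinmx_pencil k ha.
(* The completed matrix is central for p + 1. The diagonal that was added is removed by elements
   h[r_j, r_j], which are central for p. *)
have E : gaudin d a a k = 2^-1 *: (casimir a d (gaudinmx k + diag_mx c)
    + \sum_j (- c 0 j) *: casimir a d (delta_mx j j)).
  have -> : \sum_j (- c 0 j) *: casimir a d (delta_mx j j) =
      - casimir a d (diag_mx c).
    rewrite diag_mx_sum_delta [casimir a d (\sum_(_ < _) _)]linear_sum -sumrN.
    by apply: eq_bigr => j _; rewrite scaleNr; congr (- _); exact/esym/linearZ.
  have -> : casimir a d (gaudinmx k + diag_mx c) =
      casimir a d (gaudinmx k) + casimir a d (diag_mx c) by exact: linearD.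
  rewrite addrK casimir_gaudinmx -(scaler_nat 2 (gaudin d a a k)).
  rewrite scalerA mulVf ?scale1r //.
  by move/charf0P: char0 => ->.
rewrite E; apply: subalg_gen_scale; apply: subalg_gen_add.
  apply: subalg_gen_incl; exists 0; rewrite scale0r add0r subr0 scale1r.
  exact: (casimir_pencil ha n_gt0 skew cE).
apply: subalg_gen_sum => j; apply: subalg_gen_scale; apply: subalg_gen_incl.
(* Parameter 1 of the pencil is p, whereas parameter 0 above is p + 1. At s = 0 every diagonal
   matrix solves the linear system. *)
exists 1; rewrite scale1r subrr scale0r addr0 -[rootpoly a]addr0 -[0]/(0%:P).
apply: (casimir_pencil ha n_gt0 skew) => i l; rewrite mul0r mxE.
case: (eqVneq i j) => [->|ij]; case: (eqVneq l j) => [->|lj] /=;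
  by rewrite ?subrr ?mul0r ?mulr0.
Qed.
End Gaudin.

(** * Invariants and their lowest components *)

(** Both sides are the coefficient of X^M in X^m U V, with X^m absorbed by one factor or the other.
    The truncation is the one caused by working modulo q[t]. *)
Lemma coefM_shift (R : comNzRingType) (u v : nat -> R) (m M : nat) :
  \sum_(b < M.+1) u b * (if (m <= M - b)%N then v (M - b - m)%N else 0) =
  \sum_(b < M.+1) (if (m <= b)%N then u (b - m)%N else 0) * v (M - b)%N.
Proof.
pose U := \poly_(i < M.+1) u i; pose V := \poly_(i < M.+1) v i.
have sub_lt b : (M - b < M.+1)%N by rewrite ltnS leq_subr.
transitivity (U * ('X^m * V))`_M.
  rewrite coefM; apply: eq_bigr => b _; rewrite coefXnM !coef_poly ltn_ord.
  by rewrite -subnDA sub_lt; case: leqP.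
rewrite mulrCA mulrA coefM; apply: eq_bigr => b _.
rewrite coefXnM !coef_poly sub_lt.
by rewrite (leq_ltn_trans (leq_subr _ _) (ltn_ord b)); case: leqP.
Qed.

(** After multiplication by y - z both sides are (y - 1)^m - (z - 1)^m, the left one by binomial
    expansion; the missing term i = m is 1 - 1. *)
Lemma subr_quot_shift (R : idomainType) (y z : R) (m : nat) : y != z ->
  \sum_(i < m) ((-1) ^+ i *+ 'C(m, i)) *
    (\sum_(b < (m - i)%N) y ^+ ((m - i).-1 - b) * z ^+ b) =
  \sum_(b < m) (y - 1) ^+ (m.-1 - b) * (z - 1) ^+ b.
Proof.
rewrite -subr_eq0 => yz; apply: (mulfI yz).
have {2}-> : y - z = (y - 1) - (z - 1) by rewrite opprB addrA subrK.
rewrite -subrXX mulr_sumr.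
rewrite !exprDn -sumrB big_ord_recr /= subnn !expr0 subrr addr0.
apply: eq_bigr => i _; rewrite mulrCA -subrXX mulrBr.
by congr (_ - _); rewrite mulrC mulrnAr.
Qed.

Section Bilinear.
Context (K : fieldType) (A : comAlgType K) (U V : {linear {poly K} -> A}).

(* The linear form on K[y, z] = K[y][z] sending f(y) g(z) to U f * V g. *)
Definition bilin (C : {poly {poly K}}) : A :=
  \sum_(b < size C) U C`_b * V 'X^b.

Lemma bilinEw N (C : {poly {poly K}}) : (size C <= N)%N ->
  bilin C = \sum_(b < N) U C`_b * V 'X^b.
Proof.
move=> le; rewrite /bilin (big_ord_widen N (fun b => U C`_b * V 'X^b) le).
rewrite big_mkcond; apply: eq_bigr => b _; case: ltnP => // Cb.
by rewrite nth_default // linear0 mul0r.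
Qed.

Lemma bilin_additive : additive bilin.
Proof.
move=> C D; pose N := maxn (size C) (size D).
have CN : (size C <= N)%N by rewrite leq_maxl.
have DN : (size D <= N)%N by rewrite leq_maxr.
rewrite !(@bilinEw N) //; last first.
  by rewrite (leq_trans (size_polyD _ _)) // size_polyN geq_max CN.
rewrite -sumrB; apply: eq_bigr => b _.
by rewrite coefB linearB mulrBl.
Qed.

HB.instance Definition _ :=
  GRing.isAdditive.Build {poly {poly K}} A bilin bilin_additive.

Lemma bilin_scale (c : K) C : bilin (c%:P%:P * C) = c *: bilin C.
Proof.
rewrite !(@bilinEw (size C)) //; last first.
  by rewrite mul_polyC size_scale_leq.
rewrite scaler_sumr; apply: eq_bigr => b _.
by rewrite coefCM mul_polyC linearZ -scalerAl.
Qed.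

Lemma bilinM (f g : {poly K}) : bilin (f%:P * map_poly polyC g) = U f * V g.
Proof.
rewrite (@bilinEw (size g)); last first.
  rewrite mul_polyC (leq_trans (size_scale_leq _ _)) //.
  exact: size_poly.
have -> : V g = \sum_(b < size g) g`_b *: V 'X^b.
  rewrite -[in LHS](coefK g) poly_def linear_sum.
  by apply: eq_bigr => b _; rewrite linearZ.
rewrite mulr_sumr; apply: eq_bigr => b _.
rewrite coefCM coef_map /= [f * _]mulrC mul_polyC linearZ.
by rewrite -scalerAl -scalerAr.
Qed.
End Bilinear.

Section CurrentAlgebra.
Context (K : fieldType) (d : nat).
Local Notation S := (Sym K ('I_d * nat)%type).

Lemma curEw N (i : 'I_d) (f : {poly K}) : (size f <= N)%N ->
  cur i f = \sum_(k < N) f`_k *: svar K (i, k : nat).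
Proof.
move=> le; rewrite /cur (big_ord_widen N (fun k => f`_k *: svar K (i, k)) le).
rewrite big_mkcond; apply: eq_bigr => b _; case: ltnP => // Cb.
by rewrite nth_default // scale0r.
Qed.

Lemma cur_linear i : linear (@cur K d i).
Proof.
move=> c f g; pose N := maxn (size f) (size g).
have fN : (size f <= N)%N by rewrite leq_maxl.
have gN : (size g <= N)%N by rewrite leq_maxr.
rewrite !(@curEw N) //; last first.
  rewrite (leq_trans (size_polyD _ _)) // geq_max gN andbT.
  exact: leq_trans (size_scale_leq _ _) fN.
rewrite scaler_sumr -big_split; apply: eq_bigr => k _ /=.
by rewrite coefD coefZ scalerDl scalerA.
Qed.

HB.instance Definition _ i :=
  GRing.isLinear.Build K {poly K} S _ (@cur K d i) (cur_linear i).

Lemma curXn i k : cur i 'X^k = svar K (i, k) :> S.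
Proof.
rewrite (@curEw k.+1) ?size_polyXn // big_ord_recr /= coefXn eqxx scale1r.
rewrite big1 ?add0r // => b _.
by rewrite coefXn ltn_eqF ?scale0r.
Qed.

(* Read in S(q[t]) this is h[(t^m - u^m)/(t - u)]; read in S(t^-1 q[t^-1]),
   where (i, k) stands for x_i t^(-k-1), it is the sum of the h[t^(-a), t^(-b)]
   with a, b >= 1 and a + b = m + 1. *)
Definition sugawara (m : nat) : S :=
  \sum_(i < d) \sum_(b < m) svar K (i, (m.-1 - b)%N) * svar K (i, b : nat).

Context (q : vectType K) (br : q -> q -> q) (x : d.-tuple q).
Hypothesis skew : forall i j s, strcst br x i j s = - strcst br x i s j.

(** The truncated shift by m passes from one factor to the other by [coefM_shift], leaving a sum
    symmetric in j and s against skew structure constants. *)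
Lemma sugawara_Zhat M : Zhat br x (sugawara M).
Proof.
move=> i m; case: M => [|M].
  by rewrite [sugawara 0]big1 ?linear0 // => j _; rewrite big_ord0.
rewrite linear_sum /=.
pose v j m b : S := if (m <= b)%N then svar K (j, b - m)%N else 0.
have sder_v j b : sder (act_neg br x i m) (svar K (j, b)) =
    \sum_(s < d) strcst br x i j s *: v s m b.
  rewrite sder_svar /act_neg /v /=; case: leqP => // _.
  by rewrite big1 // => s _; rewrite scaler0.
pose G s j : S := \sum_(b < M.+1) v s m b * svar K (j, M - b)%N.
rewrite -[RHS](skew_sum G (skew i)); apply: eq_bigr => j _.
rewrite linear_sum /=.
under eq_bigr => b _ do
  rewrite mulrC (sderM_sum (sder_v j b) (sder_v j (M - b)%N)).
rewrite exchange_big; apply: eq_bigr => s _ /=.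
have -> : G s j + G j s = \sum_(b < M.+1)
    (v s m b * svar K (j, M - b)%N + svar K (j, b : nat) * v s m (M - b)%N).
  have E := coefM_shift (fun b => svar K (j, b)) (fun b => svar K (s, b)) m M.
  by rewrite [RHS]big_split; exact: (congr1 (+%R (G s j)) (esym E)).
exact/esym/scaler_sumr.
Qed.

(** Splits off the factor t + 1 common to all images: x_i t^(-k-1) goes to
    [cur1 i (('X + 1) ^+ k)]. *)
Definition cur1 i (f : {poly K}) : S := cur i (('X + 1) * f).

Lemma cur1_linear i : linear (cur1 i).
Proof. by move=> c f g; rewrite /cur1 mulrDr -scalerAr linearP. Qed.

HB.instance Definition _ i :=
  GRing.isLinear.Build K {poly K} S _ (cur1 i) (cur1_linear i).

(** The coefficients are those of [subr_quot_shift]: after the substitution of t + 1 for t^-1 they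
    turn powers of t + 1 back into powers of t. *)
Definition sugawara_shift (m : nat) : S :=
  \sum_(i < m) ((-1) ^+ i *+ 'C(m, i)) *: sugawara (m - i).

Lemma sugawara_shift_Zhat m : Zhat br x (sugawara_shift m).
Proof.
move=> i k; rewrite linear_sum big1 // => j _.
by rewrite linearZ /= (sugawara_Zhat _ i k) scaler0.
Qed.

Lemma shom_sugawara_shift m :
  shom (fun v : 'I_d * nat => cur v.1 (('X + 1) ^+ v.2.+1)) (sugawara_shift m) =
  \sum_(i < d) \sum_(b < m) cur1 i 'X^(m.-1 - b) * cur1 i 'X^b.
Proof.
(* In K[t][u], these are t + 1 and u + 1. *)
pose y : {poly {poly K}} := ('X + 1)%:P.
pose z : {poly {poly K}} := map_poly polyC ('X + 1).
have y1 : y - 1 = 'X%:P by rewrite /y polyCD polyC1 addrK.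
have z1 : z - 1 = map_poly polyC 'X by rewrite /z rmorphD rmorph1 addrK.
have yz : y != z.
  apply: contraTneq isT => /(congr1 (fun u : {poly {poly K}} => (u - 1)`_0)).
  rewrite y1 z1 map_polyX coefC coefX /= => /eqP.
  by rewrite polyX_eq0.
have bilinXX i (f g : {poly K}) k l : bilin (cur1 i) (cur1 i)
    ((f%:P) ^+ k * (map_poly polyC g) ^+ l) = cur1 i (f ^+ k) * cur1 i (g ^+ l).
  by rewrite -!rmorphXn bilinM.
have shomE k : shom (fun v : 'I_d * nat => cur v.1 (('X + 1) ^+ v.2.+1))
    (sugawara k) = \sum_(i < d) bilin (cur1 i) (cur1 i)
      (\sum_(b < k) y ^+ (k.-1 - b) * z ^+ b).
  rewrite rmorph_sum; apply: eq_bigr => i _; rewrite rmorph_sum raddf_sum.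
  apply: eq_bigr => b _.
  transitivity (cur1 i (('X + 1) ^+ (k.-1 - b)) * cur1 i (('X + 1) ^+ b)).
    by rewrite rmorphM /cur1 -!exprS; congr (_ * _); exact: shom_svar.
  exact/esym/bilinXX.
rewrite linear_sum.
under eq_bigr => k _ do rewrite linearZ /= shomE scaler_sumr.
rewrite exchange_big; apply: eq_bigr => i _ /=.
transitivity (bilin (cur1 i) (cur1 i)
    (\sum_(b < m) (y - 1) ^+ (m.-1 - b) * (z - 1) ^+ b)).
  rewrite -subr_quot_shift // raddf_sum; apply: eq_bigr => k _.
  by rewrite -bilin_scale !rmorphMn !rmorphXn !rmorphN1.
rewrite y1 z1 raddf_sum; apply: eq_bigr => b _.
exact: bilinXX.
Qed.
End CurrentAlgebra.

Lemma tdegM (d : nat) (m1 m2 : {cmonom ('I_d * nat)%type}) :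
  tdeg (mmul m1 m2) = (tdeg m1 + tdeg m2)%N.
Proof.
have tdegEw (m : {cmonom ('I_d * nat)%type}) (A : {fset ('I_d * nat)%type}) :
    (finsupp m `<=` A)%fset -> tdeg m = (\sum_(v <- A) m v * v.2)%N.
  move=> le; rewrite /tdeg (big_fset_incl _ le) // => v _.
  by rewrite memNfinsupp => /eqP ->.
rewrite (tdegEw _ _ (fsubset_refl _)) mdomD.
rewrite (tdegEw _ _ (fsubsetUl (finsupp m1) (finsupp m2))).
rewrite (tdegEw _ _ (fsubsetUr (finsupp m1) (finsupp m2))) -big_split.
by apply: eq_bigr => v _; rewrite cmM mulnDl.
Qed.

Lemma tdegU (d : nat) (v : 'I_d * nat) : tdeg (ucm v) = v.2.
Proof. by rewrite /tdeg mdomU big_seq_fset1 cmUU mul1n. Qed.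

Lemma mulrDD (R : pzSemiRingType) (a b c e : R) :
  (a + b) * (c + e) = a * c + a * e + (b * c + b * e).
Proof. by rewrite mulrDl !mulrDr. Qed.

(** * Homogeneous components for the t-degree *)

Section Components.
Context (K : fieldType) (d : nat).
Local Notation S := (Sym K ('I_d * nat)%type).

(** Written through [mmap], the component inherits additivity, which the sum over the support of F
    hides. *)
Lemma tcompE r (F : S) : tcomp r F =
  mmap (@malgC {cmonom ('I_d * nat)%type} K)
    (fun m => if tdeg m == r then smon K m else 0) F.
Proof.
rewrite /tcomp mmapE big_mkcond; apply: eq_bigr => m _.
by case: (tdeg m == r); [rewrite mul_malgC smonZ | rewrite [RHS]mulr0].
Qed.

Lemma tcomp_additive r : additive (@tcomp K d r).
Proof. by move=> F G; rewrite !tcompE; exact: raddfB. Qed.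

HB.instance Definition _ r :=
  GRing.isAdditive.Build S S (@tcomp K d r) (tcomp_additive r).

Lemma tcompM2 r (u v : 'I_d * nat) : tcomp r (svar K u * svar K v) =
  if (u.2 + v.2)%N == r then svar K u * svar K v else 0.
Proof.
have -> : svar K u * svar K v = smon K (mmul (ucm u) (ucm v)).
  by rewrite smonM.
by rewrite tcompE [LHS]mmapU [X in X * _]mpolyC1E mul1r tdegM !tdegU.
Qed.

(** Since [cur1 i 'X^k] is x_i t^(k+1) + x_i t^k, each product has a single term of least degree,
    and this degree is m - 1 for all of them. *)
Lemma lowest_tcomp_sugawara m : (0 < m)%N -> sugawara K d m != 0 ->
  lowest_tcomp
    (\sum_(i < d) \sum_(b < m) cur1 i 'X^(m.-1 - b) * cur1 i 'X^b)
    (sugawara K d m).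
Proof.
move=> m0 nz.
have cur1X (i : 'I_d) k : cur1 i 'X^k = svar K (i, k.+1) + svar K (i, k) :> S.
  by rewrite /cur1 mulrDl mul1r -exprS linearD /= !curXn.
have tcompXX r (i : 'I_d) k l : (r <= k + l)%N ->
    tcomp r (cur1 i 'X^k * cur1 i 'X^l : S) =
    if (k + l)%N == r then svar K (i, k) * svar K (i, l) else 0.
  move=> le; rewrite (cur1X i k) (cur1X i l) mulrDD.
  have tD (F G : S) : tcomp r (F + G) = tcomp r F + tcomp r G by exact: raddfD.
  rewrite [LHS]tD [X in X + _ = _]tD [X in _ + X = _]tD.
  have t0 k' l' : (r < k' + l')%N ->
      tcomp r (svar K (i, k') * svar K (i, l') : S) = 0.
    by move=> rkl; rewrite tcompM2 gtn_eqF.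
  have T1 : tcomp r (svar K (i, k.+1) * svar K (i, l.+1) : S) = 0.
    by apply: t0; rewrite addnS ltnS ltnW // addSn ltnS.
  have T2 : tcomp r (svar K (i, k.+1) * svar K (i, l) : S) = 0.
    by apply: t0; rewrite addSn ltnS.
  have T3 : tcomp r (svar K (i, k) * svar K (i, l.+1) : S) = 0.
    by apply: t0; rewrite addnS ltnS.
  have T4 := tcompM2 r (i, k) (i, l).
  apply: etrans (congr2 +%R (congr2 +%R T1 T2) (congr2 +%R T3 T4)) _.
  by rewrite addr0 !add0r.
have degE (b : 'I_m) : (m.-1 - b + b)%N = m.-1.
  by rewrite subnK // -ltnS prednK.
exists m.-1; split=> // [|s sm]; rewrite raddf_sum.
  apply: eq_bigr => i _; rewrite raddf_sum; apply: eq_bigr => b _.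
  by rewrite /= tcompXX degE ?eqxx.
apply: big1 => i _; rewrite raddf_sum; apply: big1 => b _.
by rewrite /= tcompXX degE ?(ltnW sm) // gtn_eqF.
Qed.

(** Setting every variable to 1 gives d m, which is nonzero in characteristic 0. *)
Lemma sugawara_neq0 (char0 : [pchar K] =i pred0) m :
  (0 < d)%N -> (0 < m)%N -> sugawara K d m != 0.
Proof.
move=> d0 m0; apply: contraTneq isT => E.
pose ev := mmap idfun (moneval (fun _ : 'I_d * nat => 1 : K)).
have ev2 u v : ev (svar K u * svar K v) = 1.
  rewrite [LHS]rmorphM -[RHS](mulr1 1); congr (_ * _); exact: mmap_svar.
have evE : ev (sugawara K d m) = \sum_(i < d) \sum_(b < m) 1.
  rewrite [LHS]raddf_sum; apply: eq_bigr => i _; rewrite [LHS]raddf_sum.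
  by apply: eq_bigr => b _; exact: ev2.
have : ev (sugawara K d m) = 0 by rewrite E [LHS]raddf0.
rewrite evE.
rewrite !sumr_const !card_ord -mulrnA => /eqP.
by move/charf0P: char0 => ->; rewrite muln_eq0 !eqn0Ngt d0 m0.
Qed.
End Components.

(** The polynomial 3 c^2 - 2 c^3 fixes 0 and 1, and its derivative 6 c (1 - c) vanishes there. *)
Lemma horner_smoothstep (K : fieldType) (r : {poly K}) (x : K) (c : bool)
    (g := 3%:R *: r ^+ 2 - 2%:R *: r ^+ 3 : {poly K}) :
  r.[x] = c%:R -> g.[x] = c%:R /\ g^`().[x] = 0.
Proof.
move=> rx; have -> : g = 3%:R *: (r * r) - 2%:R *: (r * (r * r)).
  by rewrite /g expr2 exprS expr2.
rewrite derivB !derivZ !derivM hornerD hornerN !hornerZ !hornerM.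
rewrite hornerD hornerN !hornerZ !(hornerD, hornerM) !rx.
by case: c {rx}; rewrite ?mulr0n ?mulr1n /=; split; ring.
Qed.

(** * Gaudin Hamiltonians as images of lowest components *)

Section LowestComponents.
Context (K : fieldType) (char0 : [pchar K] =i pred0) (d n : nat).
Context (d_gt0 : (0 < d)%N) (a : 'I_n -> K) (ha : injective a).
Context (q : vectType K) (br : q -> q -> q) (x : d.-tuple q).
Hypothesis skew : forall i j s, strcst br x i j s = - strcst br x i s j.

Lemma sugawara_Zv m : Zv br x (sugawara K d m).
Proof.
case: m => [|m].
  (* Lowest components are nonzero, so the zero element [sugawara 0] enters as a scalar. *)
  rewrite [sugawara _ _ _]big1 => [|i _]; last by rewrite big_ord0.
  by rewrite -(scale0r 1); apply: subalg_gen_scal.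
apply: subalg_gen_incl.
exists (\sum_(i < d) \sum_(b < m.+1) cur1 i 'X^(m - b) * cur1 i 'X^b).
  exists (sugawara_shift K d m.+1); first exact: sugawara_shift_Zhat.
  by rewrite shom_sugawara_shift.
by apply: lowest_tcomp_sugawara => //; apply: sugawara_neq0.
Qed.

Lemma wcls_rootpolyXn (i : 'I_d) k :
  wcls n (rootpoly a) i 'X^k =
  \sum_l a l ^+ k *: wcls n (rootpoly a) i (rpoly a l).
Proof.
transitivity (wcls n (rootpoly a) i (\sum_l a l ^+ k *: rpoly a l)
   : Sym K ('I_d * 'I_n)%type).
  apply: wcls_eq.
  have -> : \sum_l a l ^+ k *: rpoly a l = 'X^k %% rootpoly a.
    by rewrite modp_rootpoly //; apply: eq_bigr => l _; rewrite hornerXn.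
  by rewrite [RHS]modp_small // ltn_modp -size_poly_gt0 size_rootpoly.
by rewrite linear_sum; apply: eq_bigr => l _; exact: linearZ.
Qed.

(** Modulo p, t^b is the sum of the a_l^b r_l, so the matrix holds the divided differences of X^m at
    the roots. *)
Lemma psi_sugawara m : psi n (rootpoly a) (sugawara K d m) =
  casimir a d (\matrix_(k, l) \sum_(b < m) a k ^+ (m.-1 - b) * a l ^+ b).
Proof.
rewrite /psi rmorph_sum; apply: eq_bigr => i _; rewrite rmorph_sum.
transitivity (\sum_(b < m) \sum_k \sum_l (a k ^+ (m.-1 - b) * a l ^+ b) *:
  (wcls n (rootpoly a) i (rpoly a k) * wcls n (rootpoly a) i (rpoly a l))
   : Sym K ('I_d * 'I_n)%type).
  apply: eq_bigr => b _.
  transitivity (wcls n (rootpoly a) i 'X^(m.-1 - b) * wcls n (rootpoly a) i 'X^b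
     : Sym K ('I_d * 'I_n)%type).
    by rewrite rmorphM; congr (_ * _); exact: shom_svar.
  rewrite !wcls_rootpolyXn [LHS]mulr_suml; apply: eq_bigr => k _.
  rewrite [LHS]mulr_sumr; apply: eq_bigr => l _.
  by rewrite -scalerAl -scalerAr scalerA.
rewrite exchange_big; apply: eq_bigr => k _.
rewrite exchange_big; apply: eq_bigr => l _.
by rewrite mxE [RHS]scaler_suml.
Qed.

(** The entries are the divided differences of g. On the diagonal they are g'(a_i) = 0, in agreement
    with the convention 0 / 0 = 0 in [gaudinmx]. *)
Lemma sum_quot_gaudinmx k
    (g := 3%:R *: rpoly a k ^+ 2 - 2%:R *: rpoly a k ^+ 3 : {poly K}) :
  \sum_(m < size g) g`_m *:
    \matrix_(i, j) (\sum_(b < m) a i ^+ (m.-1 - b) * a j ^+ b) = gaudinmx a k.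
Proof.
apply/matrixP => i j; rewrite summxE [RHS]mxE.
transitivity (\sum_(m < size g)
    g`_m * \sum_(b < m) a i ^+ (m.-1 - b) * a j ^+ b).
  by apply: eq_bigr => m _; rewrite !mxE.
have gE l : g.[a l] = (l == k)%:R.
  by rewrite /g eq_sym (horner_smoothstep (horner_rpoly ha k l)).1.
case: (eqVneq i j) => [<-|ij].
  transitivity g^`().[a i]; last first.
    by rewrite /g (horner_smoothstep (horner_rpoly ha k i)).2 !subrr mul0r.
  rewrite -[in RHS](coefK g) poly_def raddf_sum horner_sum.
  apply: eq_bigr => m _; rewrite /= derivZ derivXn hornerZ hornerMn hornerXn.
  congr (_ * _); transitivity (\sum_(b < m) a i ^+ m.-1).
    apply: eq_bigr => b _; rewrite -exprD subnK // -ltnS prednK ?ltn_ord //.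
    exact: leq_ltn_trans (ltn_ord b).
  by rewrite sumr_const card_ord.
have aij : a i - a j != 0 by rewrite subr_eq0; apply: contra_neq ij => /ha.
apply: (mulIf aij); rewrite divfK // -!gE !horner_coef mulr_suml -sumrB.
by apply: eq_bigr => m _; rewrite -mulrA [X in _ * X]mulrC -subrXX mulrBr.
Qed.

Lemma gaudin_psi_Zv k :
  exists2 F, Zv br x F & gaudin d a a k = psi n (rootpoly a) F.
Proof.
pose g : {poly K} := 3%:R *: rpoly a k ^+ 2 - 2%:R *: rpoly a k ^+ 3.
exists (2^-1 *: \sum_(m < size g) g`_m *: sugawara K d m).
  apply: subalg_gen_scale; apply: subalg_gen_sum => m.
  by apply: subalg_gen_scale; exact: sugawara_Zv.
have psi_g : psi n (rootpoly a) (\sum_(m < size g) g`_m *: sugawara K d m) =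
    gaudin d a a k *+ 2.
  rewrite -casimir_gaudinmx -sum_quot_gaudinmx -/g.
  rewrite [LHS]linear_sum [RHS]linear_sum; apply: eq_bigr => m _.
  rewrite [LHS]linearZ [RHS]linearZ.
  exact: congr1 (psi_sugawara m).
transitivity (2^-1 *: psi n (rootpoly a)
    (\sum_(m < size g) g`_m *: sugawara K d m)); last exact/esym/linearZ.
rewrite psi_g -(scaler_nat 2 (gaudin d a a k)) [RHS]scalerA mulVf ?scale1r //.
by move/charf0P: char0 => ->.
Qed.
End LowestComponents.

Theorem theorem4p15 (K : closedFieldType) (char0 : [pchar K] =i pred0)
    (N : nat) (Q : 'M[K]_N -> Prop) (hQ : algebraic_group Q)
    (q : vectType K) (br : q -> q -> q) (hbr : lie_bracket br)
    (phi : {linear q -> 'M[K]_N}) (hphi : lie_of_group Q br phi)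
    (B : q -> q -> K) (hB : quadratic_form Q phi B)
    (d : nat) (x : d.-tuple q) (hx : orthonormal_basis B x)
    (hnab : exists u v, br u v != 0)
    (n : nat) (hn : (2 <= n)%N) (a : 'I_n -> K) (ha : injective a)
    (k : 'I_n) :
  (exists2 F, Zv br x F & gaudin d a a k = psi n (rootpoly a) F) /\
  Zpencil br x (rootpoly a) (rootpoly a + 1) (gaudin d a a k).
Proof.
have skew : forall i j s, strcst br x i j s = - strcst br x i s j.
  by move=> i j s; apply: (strcst_skew hQ hphi hB hx).
have swap : forall i j s, strcst br x i j s = - strcst br x j i s.
  by move=> i j s; apply: strcst_swap.
(* A nonzero bracket forces q to be nonzero, which keeps the elements [sugawara] with positive index
   away from 0. *)
have d_gt0 : (0 < d)%N.
  have [[xb _] [u [v]]] := (hx, hnab); apply: contraNT.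
  rewrite -eqn0Ngt => /eqP d0; rewrite (coord_basis xb (memvf (br u v))).
  by rewrite big1 // => i _; have := ltn_ord i; rewrite [X in (_ < X)%N]d0.
split; first exact: gaudin_psi_Zv.
apply: gaudin_Zpencil => // [|i j s]; first exact: ltnW.
(* Exchanging the first and third indices takes three adjacent transpositions, hence one sign. *)
by rewrite swap skew swap opprK.
Qed.
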